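(* Let $T$ be Thompson's group $T$ with identity $e$. There are $g_1,g_2\in T\setminus\{e\}$ such that for any $r,s\in T$ there are no elements $c_1,c_2,c_3,c_4\in C_T(sr)$ with both $$G_1=\langle (sg_1r)^{c_1},(sg_1r)^{c_2},(sg_1r)^{c_3},(sg_1r)^{c_4}\rangle\quad\text{and}\quad G_2=\langle (sg_2r)^{c_1},(sg_2r)^{c_2},(sg_2r)^{c_3},(sg_2r)^{c_4}\rangle$$ free on four generators (free of rank four).
   Context: $S^1=\mathbb{R}/\mathbb{Z}$. Thompson's group $T$ is the group of orientation-preserving piecewise-linear homeomorphisms of $S^1$ that map the set $\mathbb{Z}[\frac12]/\mathbb{Z}$ of dyadic rational points to itself, are differentiable except at finitely many dyadic rational points, and whose slopes (where defined) are integer powers of $2$. It acts on $S^1$ on the left, so products are composed right to left. $C_T(x)$ is the centralizer of $x$ in $T$. Conjugation is $h^c:=chc^{-1}$. *)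

(* Defs.v *)
From HB Require Import structures.
From mathcomp Require Import all_boot all_order all_algebra.
From mathcomp Require Import all_classical all_reals all_analysis.
Import Order.TTheory GRing.Theory Num.Theory.
Import numFieldNormedType.Exports.

Set Implicit Arguments.
Unset Strict Implicit.
Unset Printing Implicit Defensive.

Local Open Scope classical_set_scope.
Local Open Scope ring_scope.

Section Thompson.
Variable R : realType.

Definition integers : zmodClosed R :=
  GRing.ZmodClosed.clone R (@Num.int_num_subdef R) _.

Definition circle : Type := quotient_topology (Quotient.quot integers).
HB.instance Definition _ := Topological.on circle.
HB.instance Definition _ := Quotient.on circle.

Definition proj (x : R) : circle := \pi_(circle)%qT x.

Lemma projP x y : proj x = proj y <-> x - y \is a Num.int.
Proof.
have h : (x - y \is a Num.int) =
    (\pi_(Quotient.quot integers)%qT x == \pi_(Quotient.quot integers)%qT y).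
  exact: Quotient.idealrBE.
by rewrite h; split=> [xy|/eqP//]; apply/eqP.
Qed.

Definition dyadic_circle : set circle :=
  proj @` [set x : R | exists (m : int) (k : nat), x = m%:~R / 2 ^+ k].

Definition homeomorphism (f : circle -> circle) : Prop :=
  exists g : circle -> circle,
    [/\ cancel f g, cancel g f, continuous f & continuous g].

(** A homeomorphism of R/Z preserves the orientation iff it has such a lift;
    the lift is unique up to an integer translation. *)
Definition increasing_lift (f : circle -> circle) (F : R -> R) : Prop :=
  [/\ continuous F, {homo F : x y / x < y},
      (forall x, F (x + 1) = F x + 1) & (forall x, proj (F x) = f (proj x))].

(** Away from finitely many dyadic points of the circle, [F] is locally affine
    (hence differentiable) with slope an integer power of 2.  Since the lift
    [F] is continuous, this says that it is piecewise linear with dyadic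
    break points and all its slopes powers of 2. *)
Definition dyadic_piecewise_linear (F : R -> R) : Prop :=
  exists B : set circle,
    [/\ finite_set B, B `<=` dyadic_circle &
        forall x, ~ B (proj x) ->
          exists k : int, \forall y \near x, F y = F x + 2 ^ k * (y - x)].

Definition thompson_map (f : circle -> circle) : Prop :=
  [/\ homeomorphism f, f @` dyadic_circle = dyadic_circle &
      exists F, increasing_lift f F /\ dyadic_piecewise_linear F].

Lemma thompson_map_id : thompson_map id.
Proof.
split; first by exists id; split=> // x A //.
  by rewrite image_id.
exists id; split; first by split=> // x A.
exists set0; split=> // x _; exists 0.
by near=> y; rewrite expr0z mul1r addrC subrK.
Unshelve. all: by end_near.
Qed.

Lemma increasing_lift_inv f g F : cancel f g -> cancel g f ->
  increasing_lift f F ->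
  exists G, [/\ cancel F G, cancel G F & increasing_lift g G].
Proof.
move=> fK gK [cF mF F1 Ff].
have FZ (n : int) x : F (x + n%:~R) = F x + n%:~R.
  have Fn (m : nat) y : F (y + m%:R) = F y + m%:R.
    by elim: m => [|m IH]; rewrite ?addr0// -natr1 !addrA F1 IH.
  case: n => n; first by rewrite -pmulrn Fn.
  by rewrite NegzE mulrNz -pmulrn -[in RHS](subrK n.+1%:R x) Fn addrK.
have mleF : {mono F : x y / x <= y} by apply: le_mono.
have mltF : {mono F : x y / x < y} by apply: leW_mono.
have iF : injective F by apply: inc_inj.
have surj y : exists x, F x = y.
  have : proj (F (repr (g (proj y)))) = proj y.
    by rewrite Ff [proj (repr _)]reprK gK.
  move/projP => /intrP[n En].
  by exists (repr (g (proj y)) - n%:~R); rewrite -mulrNz FZ mulrNz -En subKr.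
pose G y := projT1 (cid (surj y)).
have GK : cancel G F by move=> y; rewrite /G; case: cid.
have FK : cancel F G by move=> x; apply: iF; rewrite GK.
exists G; split=> //; split.
- move=> y; apply/cvgrPdist_lt => e e0.
  have h1 : F (G y - e) < y by rewrite -[ltRHS]GK mltF ltrBlDr ltrDl.
  have h2 : y < F (G y + e) by rewrite -[ltLHS]GK mltF ltrDl.
  near=> z.
  have z1 : F (G y - e) < z by near: z; exact: lt_nbhsr.
  have z2 : z < F (G y + e) by near: z; exact: lt_nbhsl.
  rewrite -[z in _ < z]GK mltF in z1.
  rewrite -[z in z < _]GK mltF in z2.
  by rewrite distrC ltr_distl z1.
- by move=> x y xy; rewrite -mltF !GK.
- by move=> x; apply: iF; rewrite F1 !GK.
- by move=> x; rewrite -[in RHS](GK x) Ff fK.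
Unshelve. all: by end_near.
Qed.

Lemma thompson_map_inv f : thompson_map f ->
  exists g, [/\ thompson_map g, cancel f g & cancel g f].
Proof.
move=> [[g [fK gK cf cg]] fD [F [lF [B [Bfin BD FB]]]]].
have [G [FK GK lG]] := increasing_lift_inv fK gK lF.
exists g; split=> //; split; first by exists f.
  rewrite -[in LHS]fD; apply/seteqP; split=> x /=.
    by case=> _ [y yD <-] <-; rewrite fK.
  by move=> xD; exists (f x); rewrite ?fK//; exists x.
exists G; split=> //; exists (f @` B); split.
- exact: finite_image.
- by rewrite -fD; exact: image_subset.
- move=> y yB; have Ff := let: And4 _ _ _ h := lF in h.
  have [|k kP] := FB (G y).
    by move=> GB; apply: yB; exists (proj (G y)) => //; rewrite -Ff GK.
  exists (- k).
  have cG := let: And4 h _ _ _ := lG in h.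
  have := cG y _ kP; rewrite nbhs_simpl /=; apply: filterS => z /=.
  rewrite !GK => Ez; rewrite [X in _ * (X - y)]Ez [y + _]addrC addrK.
  by rewrite mulrA -expfzDr// addNr expr0z mul1r addrC subrK.
Qed.

Lemma thompson_map_comp f g :
  thompson_map f -> thompson_map g -> thompson_map (f \o g).
Proof.
move=> [[f' [fK f'K cf cf']] fD [F [[cF mF F1 Ff] [B [Bfin BD FB]]]]].
move=> [[g' [gK g'K cg cg']] gD [G [[cG mG G1 Gg] [C [Cfin CD GC]]]]].
split.
- exists (g' \o f'); split; try exact: can_comp.
    by move=> x; apply: continuous_comp; [exact: cg|exact: cf].
  by move=> x; apply: continuous_comp; [exact: cf'|exact: cg'].
- by rewrite -image_comp gD fD.
- exists (F \o G); split.
    split=> [x|x y xy|x|x] /=.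
    + by apply: continuous_comp; [exact: cG|exact: cF].
    + exact/mF/mG.
    + by rewrite G1 F1.
    + by rewrite Ff Gg.
  exists (C `|` g' @` B); split.
  + by rewrite finite_setU; split=> //; exact: finite_image.
  + move=> x [/CD//|[y /BD]]; rewrite -{1}gD => -[z zD <-] <-.
    by rewrite gK.
  + move=> x xB.
    have [|k kP] := GC x; first by move=> h; apply: xB; left.
    have [|l lP] := FB (G x).
      by rewrite Gg => h; apply: xB; right; exists (g (proj x)).
    exists (l + k).
    have := cG x _ lP; rewrite nbhs_simpl /=.
    apply: filterS2 kP => y /= Ey ->.
    by rewrite [in LHS]Ey [G x + _]addrC addrK mulrA expfzDr.
Qed.

Definition thompson : Type := {f : circle -> circle | thompson_map f}.
HB.instance Definition _ := gen_eqMixin thompson.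
HB.instance Definition _ := gen_choiceMixin thompson.

Lemma thompson_eq (f g : thompson) : sval f =1 sval g -> f = g.
Proof.
case: f g => f fT [g gT] /= /funext fg; rewrite fg in fT *.
by congr exist; exact: Prop_irrelevance.
Qed.

Definition thompson_one : thompson := exist _ id thompson_map_id.

(** Composition from right to left, as [T] acts on the left. *)
Definition thompson_mul (f g : thompson) : thompson :=
  exist _ (sval f \o sval g) (thompson_map_comp (svalP f) (svalP g)).

Lemma thompson_inv_subproof (f : thompson) :
  exists g : thompson, cancel (sval f) (sval g) /\ cancel (sval g) (sval f).
Proof.
by have [g [gT fK gK]] := thompson_map_inv (svalP f); exists (exist _ g gT).
Qed.

Definition thompson_inv (f : thompson) : thompson :=
  projT1 (cid (thompson_inv_subproof f)).

Lemma thompson_mulA : associative thompson_mul.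
Proof. by move=> f g h; exact: thompson_eq. Qed.

Lemma thompson_mul1 : left_id thompson_one thompson_mul.
Proof. by move=> f; exact: thompson_eq. Qed.

Lemma thompson_mulr1 : right_id thompson_one thompson_mul.
Proof. by move=> f; exact: thompson_eq. Qed.

Lemma thompson_mulV : left_inverse thompson_one thompson_inv thompson_mul.
Proof.
move=> f; apply: thompson_eq => x /=.
by rewrite /thompson_inv; case: cid => g [fK gK] /=; exact: fK.
Qed.

Lemma thompson_mulrV : right_inverse thompson_one thompson_inv thompson_mul.
Proof.
move=> f; apply: thompson_eq => x /=.
by rewrite /thompson_inv; case: cid => g [fK gK] /=; exact: gK.
Qed.

HB.instance Definition _ := isGroup.Build thompson
  thompson_mulA thompson_mul1 thompson_mulr1 thompson_mulV thompson_mulrV.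

End Thompson.

Section FreeSubgroups.
Local Open Scope group_scope.
Variable G : groupType.

Definition centralizer (x : G) : set G := [set c | commute c x].

(** [h^c = c h c^-1]; the library's [h ^ c] is [c^-1 h c]. *)
Definition conjl (h c : G) : G := c * h * c^-1.

Definition subgroup (H : set G) : Prop :=
  [/\ H 1, (forall x y, H x -> H y -> H (x * y)) & (forall x, H x -> H x^-1)].

Definition generated (A : set G) : set G := smallest subgroup A.

(** Words in [n] letters and their inverses: [(i, true)] stands for the [i]-th
    letter and [(i, false)] for its inverse. *)
Definition word (n : nat) : Type := seq ('I_n * bool).

Definition reduced (n : nat) (w : word n) : bool :=
  sorted (fun a b => b != (a.1, ~~ a.2)) w.

Definition eval_word (n : nat) (x : 'I_n -> G) (w : word n) : G :=
  \prod_(a <- w) (if a.2 then x a.1 else (x a.1)^-1).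

(** [H] is a free group of rank [n]: it has a free basis [x] of [n] elements. *)
Definition free_of_rank (n : nat) (H : set G) : Prop :=
  exists x : 'I_n -> G,
    generated (range x) = H /\
    forall w : word n, reduced w -> w <> [::] -> eval_word x w <> 1.

End FreeSubgroups.

(* Main.v *)
From mathcomp Require Import perm.
Require Import Defs.
From mathcomp Require Import all_boot all_order all_algebra.
From mathcomp Require Import all_classical all_reals all_analysis.
From mathcomp Require Import zify ring lra.

(** Take [g1] and [g2] with disjoint supports and a common fixed point [z].
    For [c] in the centralizer of [t = s r] one has
    [(s g r)^c = g^(c s) t], so all the generators of one group are [h_i t]
    with [h_i] a conjugate of [g], and the quotients
    [(h_i t) (h_j t)^-1 = h_i h_j^-1] do not see [t] any more. Every point of
    the circle is fixed by [g1] or by [g2], so for each index [i] every point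
    is fixed by the [i]-th conjugate of [g1] or of [g2]; the point
    [p = c_0 s z] is fixed by both for [i = 0]. Distributing the three other
    indices, one of [g1], [g2] has three conjugates [h_i], [h_j], [h_k] fixing
    [p]. Then [a = h_i h_k^-1] and [b = h_j h_k^-1] are piecewise linear maps
    with a common fixed point, and two such maps satisfy a nontrivial relation
    [w(a, b) = 1] (Brin and Squier; [thompson_relation]).

    If the four elements [y_l = h_l t] generated a free group of rank four
    they would be a basis, because free groups of finite rank are Hopfian
    ([generators_freely_independent]). A relation between members of a basis
    holds between arbitrary elements of arbitrary groups ([free_relation]); so
    in [w(y_i y_k^-1, y_j y_k^-1) = 1] the letter [y_k] may be replaced by [1],
    and [w(y_i, y_j) = 1] contradicts the independence of [y_i] and [y_j].

    Hopf property: a free group of rank [n] has exactly [|S_m|^n] homomorphisms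
    to [S_m], and a generating [n]-tuple injects them into the [n]-tuples of
    [S_m], hence bijectively; so a relation of the generating tuple would hold
    for all [n]-tuples of permutations, which no nonempty reduced word does
    ([reduced_perm]).

    Relation: lift the maps to increasing homeomorphisms of the line fixing
    the integer translates of a lift of [p]. On a component of the complement
    of the common fixed points, commutators have slope 1 at both ends, hence
    compact support; as orbits are unbounded in the component, some [k]
    pushes the support off itself, and commutators with conjugates by [k] are
    relations there ([component_relator]). Relations on two invariant sets
    combine into one on their union ([relator_setU]), and since the maps are
    affine on either side of each point, compactness of a period leaves only
    finitely many sets to combine ([segment_relation]). *)

Set Implicit Arguments.
Unset Strict Implicit.
Unset Printing Implicit Defensive.

Import Order.TTheory GRing.Theory Num.Theory.
Import numFieldNormedType.Exports.

Local Open Scope classical_set_scope.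

(* The product topology also has a [proj]. *)
Local Notation proj := Defs.proj.

(** * Reduced words *)

Section Words.
Variable n : nat.
Implicit Types (a b : 'I_n * bool) (w u v : word n).

Definition inv_letter a := (a.1, ~~ a.2).

Definition inv_word w : word n := rev (map inv_letter w).

Lemma inv_letterK : involutive inv_letter.
Proof. by case=> i b; rewrite /inv_letter negbK. Qed.

Lemma inv_letter_eq a b : (inv_letter a == b) = (a == inv_letter b).
Proof. exact: (can2_eq inv_letterK inv_letterK). Qed.

Lemma inv_wordK : involutive inv_word.
Proof.
move=> w; rewrite /inv_word map_rev revK -map_comp.
by rewrite (eq_map inv_letterK) map_id.
Qed.

Lemma inv_word_cons a w : inv_word (a :: w) = rcons (inv_word w) (inv_letter a).
Proof. by rewrite /inv_word /= rev_cons. Qed.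

Lemma inv_word_rcons a w :
  inv_word (rcons w a) = inv_letter a :: inv_word w.
Proof. by rewrite /inv_word map_rcons rev_rcons. Qed.

Lemma reducedE w : reduced w = sorted (fun a b => b != inv_letter a) w.
Proof. by []. Qed.

Lemma reduced_inv w : reduced (inv_word w) = reduced w.
Proof.
rewrite !reducedE /inv_word rev_sorted sorted_map; apply: eq_sorted => a b /=.
by rewrite (inj_eq (inv_inj inv_letterK)) eq_sym inv_letter_eq.
Qed.

Lemma reduced_cat a w b u :
  reduced (rcons w a ++ b :: u) =
  [&& reduced (rcons w a), b != inv_letter a & reduced (b :: u)].
Proof.
rewrite !reducedE; case: w => [|c w] //=.
by rewrite cat_path last_rcons /= !andbA.
Qed.

Definition cancel_cons a w : word n :=
  if w is b :: w' then if b == inv_letter a then w' else a :: w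
  else [:: a].

Definition free_reduction w : word n := foldr cancel_cons [::] w.

Lemma reduced_free_reduction w : reduced (free_reduction w).
Proof.
elim: w => //= a w; case: (free_reduction w) => //= b v rv.
by case: ifP => [_|/negbT ba] /=; [exact: path_sorted rv|rewrite ba].
Qed.

End Words.

Section Evaluation.
Local Open Scope group_scope.
Variables (G : groupType) (n : nat).
Implicit Types (x y : 'I_n -> G) (w u v : word n).

Lemma eval_word_nil x : eval_word x [::] = 1.
Proof. by rewrite /eval_word big_nil. Qed.

Lemma eval_word_cons x a w :
  eval_word x (a :: w) = (if a.2 then x a.1 else (x a.1)^-1) * eval_word x w.
Proof. by rewrite /eval_word big_cons. Qed.

Lemma eval_word_letter x i : eval_word x [:: (i, true)] = x i.
Proof. by rewrite /eval_word big_seq1. Qed.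

Lemma eval_word_cat x w u :
  eval_word x (w ++ u) = eval_word x w * eval_word x u.
Proof. by rewrite /eval_word big_cat. Qed.

Lemma eval_word_inv x w : eval_word x (inv_word w) = (eval_word x w)^-1.
Proof.
elim: w => [|a w IH]; first by rewrite !eval_word_nil invg1.
rewrite inv_word_cons -cats1 eval_word_cat IH !eval_word_cons eval_word_nil.
by rewrite mulg1 invgM; case: a => i [] /=; rewrite ?invgK.
Qed.

Lemma eval_word_free_reduction x w :
  eval_word x (free_reduction w) = eval_word x w.
Proof.
elim: w => //= a w; rewrite eval_word_cons => <-.
case: (free_reduction w) => [|b v] //=; first by rewrite eval_word_cons.
case: eqP => [->|_]; last by rewrite eval_word_cons.
by rewrite eval_word_cons mulgA; case: a => i [] /=;
  rewrite ?mulgV ?mulVg mul1g.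
Qed.

Lemma eq_eval_word x y w : x =1 y -> eval_word x w = eval_word y w.
Proof. by move=> xy; apply: eq_bigr => a _; rewrite xy. Qed.

Definition freely_independent x : Prop :=
  forall w, reduced w -> w <> [::] -> eval_word x w <> 1.

Lemma generatedP x g :
  generated (range x) g <-> exists w, eval_word x w = g.
Proof.
split=> [gx|[w <-{g}] H [[H1 HM HV] xH]].
- apply: (gx [set g | exists w, eval_word x w = g]); split.
    split; first by exists [::]; rewrite eval_word_nil.
      by move=> _ _ [u <-] [v <-]; exists (u ++ v); rewrite eval_word_cat.
    by move=> _ [u <-]; exists (inv_word u); rewrite eval_word_inv.
  by move=> _ [i _ <-]; exists [:: (i, true)]; rewrite eval_word_letter.
- elim: w => [|[i b] w IH]; first by rewrite eval_word_nil.
  have Hi : H (x i) by apply: xH; exists i.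
  by rewrite eval_word_cons; apply: HM => //=; case: b => //; exact: HV.
Qed.

End Evaluation.

Section Substitution.
Variables (m n : nat).

Definition subst_word (u : 'I_m -> word n) (w : word m) : word n :=
  flatten [seq if a.2 then u a.1 else inv_word (u a.1) | a <- w].

Lemma eval_subst_word (G : groupType) (x : 'I_n -> G) u w :
  eval_word x (subst_word u w) = eval_word (fun i => eval_word x (u i)) w.
Proof.
elim: w => [|a w IH]; first by rewrite !eval_word_nil.
rewrite eval_word_cons -IH.
by case: a => i [] /=; rewrite eval_word_cat ?eval_word_inv.
Qed.

Lemma reduced_map (f : 'I_m -> 'I_n) (w : word m) : injective f ->
  reduced [seq (f a.1, a.2) | a <- w] = reduced w.
Proof.
move=> fI; rewrite !reducedE sorted_map; apply: eq_sorted => a b /=.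
by rewrite /inv_letter /= -!pair_eqE /pair_eq /= (inj_eq fI).
Qed.

Lemma eval_word_map (G : groupType) (x : 'I_n -> G) (f : 'I_m -> 'I_n) w :
  eval_word x [seq (f a.1, a.2) | a <- w] = eval_word (x \o f) w.
Proof. by rewrite /eval_word big_map. Qed.

End Substitution.

(** * Free families and the Hopf property *)

Section FreeFamilies.
Local Open Scope group_scope.

(** The free reduction of [u v^-1] is a relation of [x], hence empty, and
    cancelling inverse letters is valid in every group. *)
Lemma free_relation n (G H : groupType) (x : 'I_n -> G) (z : 'I_n -> H) u v :
  freely_independent x -> eval_word x u = eval_word x v ->
  eval_word z u = eval_word z v.
Proof.
move=> xF xuv; apply: (mulIg (eval_word z v)^-1).
have {xuv}: eval_word x (u ++ inv_word v) = 1.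
  by rewrite eval_word_cat eval_word_inv xuv mulgV.
rewrite mulgV -eval_word_inv -eval_word_cat.
rewrite -!(eval_word_free_reduction _ (_ ++ _)).
have := reduced_free_reduction (u ++ inv_word v).
case: (free_reduction _) => [|a w] rw; first by rewrite !eval_word_nil.
by move=> E; case: (xF _ rw _ E).
Qed.

Lemma perm_extension (T : finType) (A : {set T}) (f : T -> T) :
  {in A &, injective f} -> exists s : {perm T}, {in A, s =1 f}.
Proof.
move=> fI; pose B := ~: (f @: A)%SET; pose C := ~: A.
have CB : #|C| = #|B|.
  by apply/eqP; rewrite -(eqn_add2l #|A|) cardsC -(card_in_imset fI) cardsC.
pose g x := if x \in A then f x else nth x (enum B) (index x (enum C)).
have iC x : x \notin A -> index x (enum C) < size (enum B).
  by move=> xA; rewrite -cardE -CB cardE index_mem mem_enum inE.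
have gB x : x \notin A -> g x \notin (f @: A)%SET.
  move=> xA; rewrite /g (negbTE xA).
  have : nth x (enum B) (index x (enum C)) \in enum B by exact/mem_nth/iC.
  by rewrite mem_enum inE.
have gA x : x \in A -> g x \in (f @: A)%SET.
  by move=> xA; rewrite /g xA; exact: imset_f.
have gI : injective g.
  move=> x y; have [xA|xA] := boolP (x \in A); have [yA|yA] := boolP (y \in A).
  - by rewrite /g xA yA; exact: fI.
  - by move=> gxy; have := gB y yA; rewrite -gxy gA.
  - by move=> gxy; have := gB x xA; rewrite gxy gA.
  - rewrite /g (negbTE xA) (negbTE yA) (set_nth_default x y) ?iC//.
    move/eqP; rewrite nth_uniq ?iC ?enum_uniq// => /eqP.
    by move/(index_inj x); apply; rewrite mem_enum inE.
by exists (perm gI) => x xA; rewrite permE /g xA.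
Qed.

(** The letters of [w] label the edges of a path with vertices [0 .. size w].
    As [w] is reduced, the edges labelled [i] form a partial injection of the
    vertices; permutations extending these make [w] carry [0] to [size w]. *)
Lemma reduced_perm n (w : word n) : reduced w -> w <> [::] ->
  exists m (s : 'I_n -> 'S_m), eval_word s w <> 1.
Proof.
move=> rw w0; exists (size w).+1.
have [a0 _] : exists a0, a0 \in w.
  by case: (w) w0 => // a u _; exists a; exact: mem_head.
pose L j := nth a0 w j.
have rL j : j.+1 < size w -> L j.+1 != inv_letter (L j).
  by have := rw; rewrite reducedE => /(sortedP a0); apply.
pose up i (j : nat) := (j < size w) && (L j == (i, true)).
pose dn i (j : nat) := [&& 0 < j, j <= size w & L j.-1 == (i, false)].
pose f i (j : 'I_(size w).+1) : 'I_(size w).+1 :=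
  if up i j then inord j.+1 else inord j.-1.
pose dom i := [set j : 'I_(size w).+1 | up i (val j) || dn i (val j)]%SET.
have ext i : exists s : 'S_(size w).+1, {in dom i, s =1 f i}.
  apply: perm_extension => j k; rewrite !inE /f.
  have up_dn p : up i p -> dn i p.+2 -> False.
    move=> /andP[_ /eqP Lp] /and3P[_ sp /= /eqP Lp1].
    by have := rL p sp; rewrite Lp Lp1 eqxx.
  have jS : j <= size w by rewrite -ltnS.
  have kS : k <= size w by rewrite -ltnS.
  case uj: (up i j); case uk: (up i k) => /= dj dk /(congr1 val).
  - have /andP[ju _] := uj; have /andP[ku _] := uk.
    by rewrite /= !inordK// => -[/val_inj].
  - have /andP[ju _] := uj.
    rewrite /= !inordK//; last by rewrite ltnS (leq_trans (leq_pred _)).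
    move=> E; have := up_dn _ uj; rewrite E.
    by case/and3P: (dk) => k0 _ _; rewrite prednK// => /(_ dk).
  - have /andP[ku _] := uk.
    rewrite /= !inordK//; last by rewrite ltnS (leq_trans (leq_pred _)).
    move=> E; have := up_dn _ uk; rewrite -E.
    by case/and3P: (dj) => j0 _ _; rewrite prednK// => /(_ dj).
  - rewrite /= !inordK ?ltnS ?(leq_trans (leq_pred _))//.
    case/and3P: dj => j0 _ _; case/and3P: dk => k0 _ _ E.
    by apply: val_inj; rewrite /= -(prednK j0) E prednK.
pose s i := projT1 (cid (ext i)).
have sP i : {in dom i, s i =1 f i}.
  by rewrite /s; case: cid.
exists s.
suff walk k : k <= size w ->
    eval_word s (take k w) (inord 0) = inord k :> 'I_(size w).+1.
  move=> E; have := walk _ (leqnn _); rewrite take_size E perm1.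
  move/(congr1 val); rewrite /= !inordK// => /esym/size0nil.
  exact: w0.
elim: k => [|k IH] ks; first by rewrite take0 eval_word_nil perm1.
rewrite (take_nth a0)// -cats1 eval_word_cat permM IH ?(ltnW ks)//.
rewrite eval_word_cons eval_word_nil mulg1 -/(L k).
case Lk: (L k) => [i b] /=; case: b Lk => Lk.
- have uk : up i k by rewrite /up ks Lk eqxx.
  by rewrite sP ?inE /f /= inordK ?uk// ltnW.
- have dk : dn i k.+1 by rewrite /dn ks /= Lk eqxx.
  apply: (canLR (permK _)); rewrite sP ?inE /f /= inordK ?dk ?orbT//.
  case: ifP => // /andP[k1 /eqP Lk1].
  by have := rL k k1; rewrite Lk Lk1 eqxx.
Qed.

(** Homomorphisms from the free group to ['S_m] are the families [s] of their
    values on the basis [x]; [Phi] sends such a family to the values on [y].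
    It is injective because [y] generates, hence surjective by finiteness. *)
Lemma generators_freely_independent n (G : groupType) (y : 'I_n -> G) :
  free_of_rank n (generated (range y)) -> freely_independent y.
Proof.
move=> [x [xy xF]] w rw w0 yw.
have [m [p pw]] := reduced_perm rw w0.
have xE i : exists u, eval_word x u = y i.
  by apply/generatedP; rewrite xy => H; case=> _; apply; exists i.
have yE i : exists u, eval_word y u = x i.
  by apply/generatedP; rewrite -xy => H; case=> _; apply; exists i.
pose u i := projT1 (cid (xE i)); pose v i := projT1 (cid (yE i)).
have uE i : eval_word x (u i) = y i by rewrite /u; case: cid.
have vE i : eval_word y (v i) = x i by rewrite /v; case: cid.
pose Phi (s : {ffun 'I_n -> 'S_m}) : {ffun 'I_n -> 'S_m} :=
  [ffun i => eval_word s (u i)].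
have PhiE s i : eval_word (Phi s) (v i) = s i.
  rewrite -(eval_word_letter s) 
    -[RHS](@free_relation _ _ _ x s (subst_word u (v i)))//.
    by rewrite eval_subst_word; apply: eq_eval_word => j; rewrite ffunE.
  by rewrite eval_subst_word (eq_eval_word _ uE) vE eval_word_letter.
have PhiI : injective Phi.
  by move=> s t st; apply/ffunP => i; rewrite -!PhiE st.
have [Psi _ PsiK] := injF_bij PhiI.
pose s := Psi (finfun p); apply: pw.
have <- : eval_word s (subst_word u w) = eval_word p w.
  rewrite eval_subst_word; apply: eq_eval_word => i.
  by have := congr1 (fun f : {ffun _} => f i) (PsiK (finfun p)); rewrite !ffunE.
rewrite -(eval_word_nil s); apply: (free_relation _ xF).
by rewrite eval_subst_word (eq_eval_word _ uE) yw eval_word_nil.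
Qed.

End FreeFamilies.

(** * Commutator words *)

Section CommutatorWords.
Variable n : nat.
Implicit Types (w u v k : word n.+2).

Definition commutator_letters (a b : 'I_n.+2 * bool) : word n.+2 :=
  [:: a; b; inv_letter a; inv_letter b].

(** The commutator of [w] and [k v k^-1], spelled without cancellation. *)
Definition conj_commutator w k v : word n.+2 :=
  flatten [:: w; k; v; inv_word k; inv_word w; k; inv_word v; inv_word k].

Let l0 : 'I_n.+2 * bool := (ord0, true).

Lemma reduced_flatten (bs : seq (word n.+2)) :
  all (fun w => w != [::]) bs -> all (@reduced _) bs ->
  sorted (fun w u => head l0 u != inv_letter (last l0 w)) bs ->
  reduced (flatten bs).
Proof.
elim: bs => // w [|u bs] IH; first by rewrite /= cats0 => _ /andP[].
move=> /andP[w0 bs0] /andP[rw rbs] /andP[wu bsS].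
have {IH} := IH bs0 rbs bsS; move: bs0 wu {rbs bsS} => /andP[+ _].
case: u => // b u _; case/lastP: w w0 rw => // w a _ rw.
rewrite last_rcons => ba rb.
by rewrite -[flatten _]/(rcons w a ++ b :: (u ++ flatten bs)) reduced_cat rw ba.
Qed.

Lemma head_inv w : w != [::] -> head l0 (inv_word w) = inv_letter (last l0 w).
Proof. by case/lastP: w => // w a _; rewrite inv_word_rcons last_rcons. Qed.

Lemma last_inv w : w != [::] -> last l0 (inv_word w) = inv_letter (head l0 w).
Proof. by case: w => // a w _; rewrite inv_word_cons last_rcons. Qed.

Lemma inv_word_eq0 w : (inv_word w == [::]) = (w == [::]).
Proof. by rewrite -!size_eq0 size_rev size_map. Qed.

Lemma reduced_conj_commutator w k v :
  reduced w -> w != [::] -> reduced k -> k != [::] -> reduced v -> v != [::] ->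
  head l0 k != head l0 w -> head l0 k != inv_letter (last l0 w) ->
  last l0 k != last l0 v -> last l0 k != inv_letter (head l0 v) ->
  reduced (conj_commutator w k v).
Proof.
move=> rw w0 rk k0 rv v0 kw1 kw2 kv1 kv2; apply: reduced_flatten => /=.
- by rewrite !inv_word_eq0 w0 k0 v0.
- by rewrite !reduced_inv rw rk rv.
- rewrite !head_inv ?last_inv//.
  rewrite !(inj_eq (inv_inj (@inv_letterK _))) !inv_letterK.
  by rewrite kw1 kw2 kv1 kv2 (eq_sym (last l0 v)) kv1 (eq_sym (head l0 v))
    (eq_sym (last l0 w)) !inv_letter_eq kv2 kw2.
Qed.

Lemma fresh_letter (s : seq ('I_n.+2 * bool)) : size s <= 3 ->
  exists z, z \notin s.
Proof.
move=> s3; case: (pickP [predC s]) => [z zs|sT]; first by exists z.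
have : #|{: 'I_n.+2 * bool}| <= size s.
  rewrite (leq_trans _ (card_size s))//.
  apply/subset_leq_card/fintype.subsetP => z _.
  by have := sT z; rewrite !inE => /negbFE.
by rewrite card_prod card_ord card_bool => /leq_trans/(_ s3); lia.
Qed.

(** A [k] of length two suffices: with at least four letters available, each
    letter of [k] can avoid the at most three that would cancel. *)
Lemma reduced_conj_commutator_exists w v :
  reduced w -> w <> [::] -> reduced v -> v <> [::] ->
  exists k, reduced (conj_commutator w k v).
Proof.
move=> rw /eqP w0 rv /eqP v0.
have [//|z1] := @fresh_letter [:: head l0 w; inv_letter (last l0 w)].
have [//|z2] :=
  @fresh_letter [:: last l0 v; inv_letter (head l0 v); inv_letter z1].
rewrite !inE !negb_or => /and3P[v1 v2 z12] /andP[w1 w2].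
exists [:: z1; z2]; apply: reduced_conj_commutator => //.
by rewrite reducedE /= z12.
Qed.

(** Neither commutator alone is compatible with every [k], but a letter that
    cancels against one of them cannot cancel against the other. *)
Lemma reduced_commutator_between k : reduced k -> k <> [::] ->
  let W := [:: commutator_letters (ord0, true) (ord_max, true);
               commutator_letters (ord0, false) (ord_max, false)] in
  exists w v, [/\ w \in W, v \in W & reduced (conj_commutator w k v)].
Proof.
move=> rk /eqP k0 W.
have WP : all (fun w => reduced w && (w != [::])) W by [].
have [w wW [w1 w2]] : exists2 w, w \in W &
    head l0 k != head l0 w /\ head l0 k != inv_letter (last l0 w).
  by case: (head l0 k) => i [];
    [exists (nth [::] W 1)|exists (nth [::] W 0)];
    rewrite ?inE ?eqxx ?orbT// !xpair_eqE !andbF.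
have [v vW [v1 v2]] : exists2 v, v \in W &
    last l0 k != last l0 v /\ last l0 k != inv_letter (head l0 v).
  by case: (last l0 k) => i [];
    [exists (nth [::] W 0)|exists (nth [::] W 1)];
    rewrite ?inE ?eqxx ?orbT// !xpair_eqE !andbF.
exists w, v; split=> //.
have /andP[rw w0] := allP WP w wW; have /andP[rv v0] := allP WP v vW.
exact: reduced_conj_commutator.
Qed.

End CommutatorWords.

(** * Gluing along a segment *)

Section RealLine.
Local Open Scope ring_scope.
Variable R : realType.

(** Compactness of the segment, for properties of subsegments rather than
    covers: the supremum of the [y] with [Q a y] can always be passed. *)
Lemma segment_gluing (Q : R -> R -> Prop) (a b : R) : a <= b ->
  (forall x, a <= x <= b -> exists2 e, 0 < e &
     forall u v, x - e < u -> u <= x -> x <= v -> v < x + e -> Q u v) ->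
  (forall u v w, u <= v -> v <= w -> Q u v -> Q v w -> Q u w) ->
  Q a b.
Proof.
move=> ab locQ glueQ.
pose S := [set y | a <= y <= b /\ Q a y].
have Sa : S a.
  split; first by rewrite lexx.
  have [|e e0 He] := locQ a; first by rewrite lexx.
  by apply: He => //; lra.
have Sub : ubound S b by move=> y [/andP[]].
have hS : has_sup S by split; [exists a|exists b].
pose m := sup S.
have am : a <= m by apply: ub_le_sup => //; exists b.
have mb : m <= b by apply: ge_sup => //; exists a.
have [|e e0 He] := locQ m; first by rewrite am.
have [y [/andP[ay yb] Qay] my] := sup_adherent e0 hS.
have ym : y <= m by apply: ub_le_sup; [exists b|split=> //; rewrite ay].
have Sm v : m <= v -> v <= b -> v < m + e -> S v.
  move=> mv vb vme; split; first by rewrite (le_trans am mv).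
  by apply: (glueQ _ y) => //; [exact: le_trans mv|exact: He].
have [bm|bm] := leP b m.
  by have [] : S b by apply: Sm => //; lra.
pose v := Num.min b (m + e / 2).
have mv : m < v by rewrite lt_min bm /=; lra.
have : S v.
  apply: Sm; rewrite ?ge_min ?lexx ?(ltW mv)// gt_min.
  by apply/orP; right; lra.
by move=> Sv; have := ub_le_sup (ex_intro _ b Sub) Sv; rewrite leNgt mv.
Qed.

Lemma common_radius (I : finType) (P : I -> R -> Prop) (x : R) :
  (forall i, exists2 e, 0 < e & forall y, x < y < x + e -> P i y) ->
  exists2 e, 0 < e & forall i y, x < y < x + e -> P i y.
Proof.
move=> h; pose e i := projT1 (cid2 (h i)).
have e0 i : 0 < e i by rewrite /e; case: cid2.
have eP i y : x < y < x + e i -> P i y.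
  by rewrite /e; case: cid2 => /= ? _; apply.
exists (\big[Num.min/1]_i e i); first by apply: lt_bigmin => //; exact: ltr01.
move=> i y /andP[xy ye]; apply: eP; rewrite xy (lt_le_trans ye)// lerD2l.
exact: bigmin_le_cond.
Qed.

(** * Piecewise affine actions of words on the line *)

Definition right_affine (f : R -> R) (x : R) : Prop :=
  exists2 e, 0 < e &
    exists l, forall y, x <= y <= x + e -> f y = f x + l * (y - x).

(** Conjugation by [x |-> - x]; it exchanges left and right, so that each
    one-sided result is proved only on the right. *)
Definition point_reflection (f : R -> R) : R -> R := fun y => - f (- y).

Definition action n := 'I_n.+2 * bool -> R -> R.

Definition act n (phi : action n) (w : word n.+2) (x : R) : R := foldr phi x w.

Definition pl_action n (phi : action n) : Prop :=
  [/\ forall a, cancel (phi a) (phi (inv_letter a)),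
      forall a, {homo phi a : x y / x < y},
      forall a x, right_affine (phi a) x &
      forall a x, right_affine (point_reflection (phi a)) x].

End RealLine.

Section Action.
Local Open Scope ring_scope.
Variables (R : realType) (n : nat) (phi : action R n).
Hypothesis phiP : pl_action phi.
Implicit Types (a b : 'I_n.+2 * bool) (w u v k : word n.+2) (V : set R).

Let phiK a : cancel (phi a) (phi (inv_letter a)).
Proof. by case: phiP. Qed.

Let phiVK a : cancel (phi (inv_letter a)) (phi a).
Proof. by move=> x; have := phiK (inv_letter a) x; rewrite inv_letterK. Qed.

Let phi_lt a : {mono phi a : x y / x < y}.
Proof. by case: phiP => _ h _ _; apply/leW_mono/le_mono/h. Qed.

Let phi_le a : {mono phi a : x y / x <= y}.
Proof. by case: phiP => _ h _ _; apply/le_mono/h. Qed.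

Lemma act_cat w u x : act phi (w ++ u) x = act phi w (act phi u x).
Proof. exact: foldr_cat. Qed.

Lemma actVK w : cancel (act phi (inv_word w)) (act phi w).
Proof.
elim: w => [|a w IH] x //.
by rewrite inv_word_cons -cats1 act_cat /= IH phiVK.
Qed.

Lemma actK w : cancel (act phi w) (act phi (inv_word w)).
Proof. by move=> x; have := actVK (inv_word w) x; rewrite inv_wordK. Qed.

Lemma act_lt w : {mono act phi w : x y / x < y}.
Proof. by elim: w => //= a w IH x y; rewrite phi_lt IH. Qed.

Lemma act_le w : {mono act phi w : x y / x <= y}.
Proof. by elim: w => //= a w IH x y; rewrite phi_le IH. Qed.

Lemma act_free_reduction w x : act phi (free_reduction w) x = act phi w x.
Proof.
elim: w => //= a w <-; case: (free_reduction w) => [|b u] //=.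
by case: eqP => [->|//] /=; rewrite phiVK.
Qed.

Definition fixed : set R := [set x | forall a, phi a x = x].

Definition invariant V := forall a x, V x -> V (phi a x).

Definition has_relation V :=
  exists w, [/\ reduced w, w <> [::] & forall x, V x -> act phi w x = x].

(** Invariance is required because a word only sees the orbits it moves along:
    it lets relations on two sets be combined into one on the union. *)
Definition relator_set V := invariant V /\ has_relation V.

Lemma invariant_act V w x : invariant V -> V x -> V (act phi w x).
Proof. by move=> iV Vx; elim: w => //= a w; exact: iV. Qed.

Lemma act_fixed w x : fixed x -> act phi w x = x.
Proof. by move=> fx; elim: w => //= a w ->. Qed.

Lemma trivial_inv w V x : (forall x, V x -> act phi w x = x) ->
  V x -> act phi (inv_word w) x = x.
Proof. by move=> wV Vx; rewrite -[in LHS](wV _ Vx) actK. Qed.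

(** The maps permute an invariant set and preserve the order, so they fix its
    supremum. This yields both the ends of the components of the complement
    of the fixed points and the unboundedness of orbits inside them. *)
Lemma sup_fixed V : invariant V -> has_sup V -> fixed (sup V).
Proof.
move=> iV hV; have [V0 Vub] := hV.
have le a : phi a (sup V) <= sup V.
  rewrite leNgt; apply/negP => h.
  have : phi (inv_letter a) (sup V) < sup V by rewrite -(phi_lt a) phiVK.
  move/(sup_gt V0) => [s Vs]; rewrite -(phi_lt a) phiVK.
  by apply/negP; rewrite -leNgt; apply: ub_le_sup => //; exact: iV.
move=> a; apply/eqP; rewrite eq_le le /=.
by rewrite -(phi_le (inv_letter a)) phiK.
Qed.

Lemma act_conj_commutator w k v x : act phi (conj_commutator w k v) x =
  act phi w (act phi k (act phi v (act phi (inv_word k)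
    (act phi (inv_word w)
      (act phi k (act phi (inv_word v) (act phi (inv_word k) x))))))).
Proof. by rewrite /conj_commutator /= cats0 !act_cat. Qed.

(** In the commutator of [w] and [k v k^-1] the factors [w^{+-1}] disappear on
    [V], the factors [v^{+-1}] disappear on [U], and what remains cancels; [k]
    is there only to keep the word reduced. *)
Lemma relator_setU V U : relator_set V -> relator_set U ->
  relator_set (V `|` U).
Proof.
move=> [iV [w [rw w0 wV]]] [iU [v [rv v0 vU]]].
split; first by move=> a x [/iV|/iU] h; [left|right]; exact: h.
have [k rk] := reduced_conj_commutator_exists rw w0 rv v0.
exists (conj_commutator w k v); split=> //; first by case: (w) w0.
move=> x; rewrite act_conj_commutator => -[Vx|Ux].
- have Vact u y : V y -> V (act phi u y) by exact: invariant_act.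
  rewrite (trivial_inv wV); last by do 3!apply: (Vact).
  by rewrite !(actK, actVK) wV.
- have Uact u y : U y -> U (act phi u y) by exact: invariant_act.
  rewrite (trivial_inv vU); last exact: Uact.
  by rewrite actVK vU ?actVK//; do 2!apply: (Uact).
Qed.

Definition right_slope (f : R -> R) (x l : R) :=
  exists2 e, 0 < e & forall y, x <= y <= x + e -> f y = x + l * (y - x).

Lemma right_slope_comp (f g : R -> R) (x l m : R) : 0 < m ->
  right_slope f x l -> right_slope g x m -> right_slope (f \o g) x (l * m).
Proof.
move=> m0 [e e0 fe] [d d0 gd]; exists (Num.min d (e / m)).
  by rewrite lt_min d0 divr_gt0.
move=> y; rewrite addr_minr le_min => /and3P[xy yd ye].
have me : m * (y - x) <= e by rewrite -lerBlDl ler_pdivlMr// mulrC in ye.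
have m1 : 0 <= m * (y - x) by rewrite mulr_ge0 ?subr_ge0// ltW.
rewrite /= gd ?xy// fe; first by ring.
by rewrite lerDl lerD2l m1 me.
Qed.

Lemma right_slope_id (f : R -> R) (x l : R) : f =1 id ->
  right_slope f x l -> l = 1.
Proof.
move=> fid [e e0 fe]; have := fe (x + e); rewrite fid lexx lerDl ltW//.
move=> /(_ isT)/addrI; rewrite (addrC x) addrK => E.
by apply: (mulIf (lt0r_neq0 e0)); rewrite mul1r.
Qed.

Lemma fixed_right_slope a x : fixed x ->
  exists2 l, 0 < l & right_slope (phi a) x l.
Proof.
move=> fx; case: phiP => _ _ /(_ a x)[e e0 [l le]] _.
rewrite fx in le; exists l; last by exists e.
have := le (x + e); rewrite lexx lerDl ltW// => /(_ isT).
rewrite (addrC x) addrK => E; have : phi a x < phi a (e + x).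
  by rewrite phi_lt ltrDr.
by rewrite fx E ltrDl pmulr_lgt0.
Qed.

(** At a common fixed point slopes are multiplicative, so a commutator has
    slope 1 there. *)
Lemma commutator_trivial_right a b x : fixed x ->
  exists2 e, 0 < e &
    forall y, x <= y <= x + e -> act phi (commutator_letters a b) y = y.
Proof.
move=> fx.
have [la la0 aS] := fixed_right_slope a fx.
have [lb lb0 bS] := fixed_right_slope b fx.
have [la' la'0 aS'] := fixed_right_slope (inv_letter a) fx.
have [lb' lb'0 bS'] := fixed_right_slope (inv_letter b) fx.
have laE : la * la' = 1.
  by apply: right_slope_id (right_slope_comp _ aS aS') => // y /=; rewrite phiVK.
have lbE : lb * lb' = 1.
  by apply: right_slope_id (right_slope_comp _ bS bS') => // y /=; rewrite phiVK.
have l2 := mulr_gt0 la'0 lb'0; have l3 := mulr_gt0 lb0 l2.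
have [e e0 He] := right_slope_comp l3 aS
  (right_slope_comp l2 bS (right_slope_comp lb'0 aS' bS')).
exists e => // y ye; have /= -> := He y ye.
have -> : la * (lb * (la' * lb')) = (la * la') * (lb * lb').
  by ring.
by rewrite laE lbE !mul1r addrC subrK.
Qed.

(** Otherwise the supremum of the orbit of [x] would be a fixed point strictly
    between [a] and [b]. *)
Lemma orbit_unbounded (x a b y : R) : a < x < b -> fixed a -> fixed b ->
  (forall z, a < z < b -> ~ fixed z) -> y < b ->
  exists w, y < act phi w x.
Proof.
move=> /andP[ax xb] fa fb nf yb.
pose O := range (act phi ^~ x).
have iO : invariant O by move=> c _ [w _ <-]; exists (c :: w).
have Ob : ubound O b by move=> _ [w _ <-]; rewrite -(act_fixed w fb) act_le ltW.
have hO : has_sup O by split; [exists x, [::]|exists b].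
have fO := sup_fixed iO hO.
have xO : x <= sup O by apply: ub_le_sup; [exists b|exists [::]].
have Ole : sup O <= b by apply: ge_sup => //; case: hO.
have ObE : sup O = b.
  apply/eqP; rewrite eq_le Ole leNgt; apply/negP => Olt.
  by apply: (nf _ _ fO); rewrite (lt_le_trans ax).
by move: yb; rewrite -ObE => /(sup_gt hO.1)[_ [w _ <-] yw]; exists w.
Qed.

End Action.

Section Component.
Local Open Scope ring_scope.
Variables (R : realType) (n : nat).
Implicit Types (phi : action R n).

Definition opp_action phi : action R n := fun a => point_reflection (phi a).

Lemma point_reflectionK (f : R -> R) :
  point_reflection (point_reflection f) = f.
Proof. by apply/funext => x; rewrite /point_reflection !opprK. Qed.

Lemma pl_opp_action phi : pl_action phi -> pl_action (opp_action phi).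
Proof.
move=> [phiK phi_lt rp lp]; split=> // [a x|a x y xy|a x].
- by rewrite /opp_action /point_reflection opprK phiK opprK.
- by rewrite /opp_action /point_reflection ltrN2 phi_lt// ltrN2.
- by rewrite /opp_action point_reflectionK.
Qed.

Lemma act_opp phi w x : act (opp_action phi) w x = - act phi w (- x).
Proof.
by elim: w => [|a w IH] /=; rewrite ?opprK//
  IH /opp_action /point_reflection opprK.
Qed.

Lemma fixed_opp phi x : fixed (opp_action phi) x <-> fixed phi (- x).
Proof.
split=> h a; have := h a; rewrite /opp_action /point_reflection;
  last by move=> ->; rewrite opprK.
by move/eqP; rewrite eqr_oppLR => /eqP.
Qed.

Lemma relator_set_opp phi V : relator_set (opp_action phi) V ->
  relator_set phi (-%R @^-1` V).
Proof.
move=> [iV [w [rw w0 wV]]]; split=> [a x /= Vx|].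
  by have := iV a _ Vx; rewrite /opp_action /point_reflection opprK.
exists w; split=> // x Vx; apply: oppr_inj.
by rewrite -[RHS]wV// act_opp opprK.
Qed.

Variable phi : action R n.
Hypothesis phiP : pl_action phi.

Lemma commutator_trivial_left a b x : fixed phi x ->
  exists2 e, 0 < e &
    forall y, x - e <= y <= x -> act phi (commutator_letters a b) y = y.
Proof.
move=> fx; have [|e e0 He] :=
  commutator_trivial_right (pl_opp_action phiP) a b (x := - x).
  by apply/fixed_opp; rewrite opprK.
exists e => // y /andP[ye yx]; apply: oppr_inj; rewrite -[RHS]He.
  by rewrite act_opp opprK.
by lra.
Qed.

(** Commutators [w], [v] of letters are supported in some [[c, d]] inside the
    component. A word [k] with [k c > d] makes the supports of [w] and
    [k v k^-1] disjoint, so these commute on the component; [w] and [v] are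
    chosen after [k] to make their commutator a reduced word. *)
Lemma component_relator (a b : R) : a < b -> fixed phi a -> fixed phi b ->
  (forall z, a < z < b -> ~ fixed phi z) ->
  relator_set phi [set x | a < x < b].
Proof.
move=> ab fa fb nf.
have iV : invariant phi [set x | a < x < b].
  move=> c x /= xab; rewrite -(act_fixed [:: c] fa) -(act_fixed [:: c] fb).
  by rewrite !(act_lt phiP [:: c]).
split=> //.
pose w1 : word n.+2 := commutator_letters (ord0, true) (ord_max, true).
pose w2 : word n.+2 := commutator_letters (ord0, false) (ord_max, false).
have [e e0 He] : exists2 e, 0 < e & forall w, w \in [:: w1; w2] ->
    forall y, (a <= y <= a + e) || (b - e <= y <= b) -> act phi w y = y.
  have [r1 r10 H1] :=
    commutator_trivial_right phiP (ord0, true) (ord_max, true) fa.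
  have [r2 r20 H2] :=
    commutator_trivial_right phiP (ord0, false) (ord_max, false) fa.
  have [s1 s10 K1] := commutator_trivial_left (ord0, true) (ord_max, true) fb.
  have [s2 s20 K2] := commutator_trivial_left (ord0, false) (ord_max, false) fb.
  exists (Num.min (Num.min r1 r2) (Num.min s1 s2)).
    by rewrite !lt_min r10 r20 s10.
  set e := Num.min _ _.
  have [[e1 e2] [e3 e4]] : (e <= r1 /\ e <= r2) /\ (e <= s1 /\ e <= s2).
    by rewrite !ge_min !lexx !orbT.
  move=> w; rewrite !inE => /orP[] /eqP -> y /orP[] /andP[y1 y2].
  - by apply: H1; lra.
  - by apply: K1; lra.
  - by apply: H2; lra.
  - by apply: K2; lra.
(* The midpoint keeps [c < b], and [c <= d] makes any [k] with [k c > d]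
   nonempty. *)
pose c := Num.min (a + e) ((a + b) / 2); pose d := Num.max (b - e) c.
have ce : c <= a + e by rewrite ge_min lexx.
have de : b - e <= d by rewrite le_max lexx.
have cd : c <= d by rewrite le_max lexx orbT.
have ac : a < c by rewrite lt_min; lra.
have cb : c < b by rewrite gt_min; lra.
have db : d < b by rewrite gt_max cb; lra.
have [k0 dk0] : exists k, d < act phi k c.
  have acb : a < c < b by rewrite ac.
  exact: (orbit_unbounded phiP acb fa fb nf db).
pose k := free_reduction k0; pose kc := act phi k c.
have dk : d < kc by rewrite /kc act_free_reduction.
have k_neq0 : k <> [::].
  by move=> E; move: dk; rewrite /kc E /= ltNge cd.
have [w [v [wW vW rwv]]] :=
  reduced_commutator_between (reduced_free_reduction k0) k_neq0.
have Vact u y : a < y < b -> a < act phi u y < b.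
  exact: (@invariant_act _ _ phi _ u y iV).
have low u y : u \in [:: w1; w2] -> a < y <= c ->
    act phi u y = y /\ act phi (inv_word u) y = y.
  move=> uW /andP[ay yc]; have uy : act phi u y = y by apply: He => //; lra.
  by split=> //; rewrite -[in LHS]uy actK.
have high u y : u \in [:: w1; w2] -> d <= y < b ->
    act phi u y = y /\ act phi (inv_word u) y = y.
  move=> uW /andP[dy yb]; have uy : act phi u y = y by apply: He => //; lra.
  by split=> //; rewrite -[in LHS]uy actK.
have lowk y : a < y <= kc ->
    act phi v (act phi (inv_word k) y) = act phi (inv_word k) y /\
    act phi (inv_word v) (act phi (inv_word k) y) = act phi (inv_word k) y.
  move=> /andP[ay yk]; apply: low => //; rewrite -(act_fixed (inv_word k) fa).
  by rewrite act_lt// ay /= -(act_le phiP k) actVK.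
exists (conj_commutator w k v); split=> //.
  by case: (w) wW; rewrite // !inE.
move=> x /= xab; have /andP[ax xb] := xab; rewrite act_conj_commutator.
have [xd|dx] := leP x d.
(* Below [d] the conjugate [k v k^-1] is the identity, above [d] it is [w];
   the first factors applied do not cross [d]. *)
- have xk : a < x <= kc by rewrite ax (le_trans xd)// ltW.
  rewrite (lowk x xk).2 actVK// (lowk _ _).1 ?actVK//.
  have /andP[-> _] := Vact (inv_word w) x xab.
  rewrite /= (le_trans _ (ltW dk))//.
  by rewrite -(high w d wW _).2 ?act_le// lexx.
- set y := act phi k (act phi (inv_word v) _); have dy : d < y.
    have [xk|kx] := leP x kc.
      have axk : a < x <= kc by rewrite ax.
      by rewrite /y (lowk x axk).2 actVK.
    have akc : a < kc <= kc.
      by rewrite lexx andbT (lt_trans ac)// (le_lt_trans cd).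
    rewrite (lt_trans dk)// -[ltLHS](actVK phiP k).
    by rewrite -(lowk kc akc).2 /y !act_lt.
  have /andP[_ yb] : a < y < b by do 3!apply: (Vact).
  rewrite (high w y wW _).2 ?(ltW dy)// /y actK// !actVK//.
  by rewrite (high w x wW _).1 // (ltW dx).
Qed.

End Component.

(** * Local relations and compactness *)

Section Relation.
Local Open Scope ring_scope.
Variables (R : realType) (n : nat).
Implicit Types (phi : action R n).

Lemma relator_set_fixed phi : relator_set phi (fixed phi).
Proof.
split=> [a x fx|]; first by rewrite fx.
by exists [:: (ord0, true)]; split=> // x; exact: act_fixed.
Qed.

Lemma letter_germ (f : R -> R) (q : R) : f q = q -> right_affine f q ->
  exists2 e, 0 < e & (forall y, q < y < q + e -> f y = y) \/
                     (forall y, q < y < q + e -> f y <> y).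
Proof.
move=> fq [e e0 [l fl]]; exists e => //; rewrite fq in fl.
have [l1|l1] := eqVneq l 1; [left|right] => y /andP[qy yq].
  by rewrite fl ?l1; lra.
rewrite fl; last by lra.
move=> E; move/eqP: l1; apply; apply: (@mulIf _ (y - q)); first by lra.
by lra.
Qed.

Lemma fixed_right_germ phi q : pl_action phi -> fixed phi q ->
  exists2 e, 0 < e & (forall y, q < y < q + e -> fixed phi y) \/
                     (forall y, q < y < q + e -> ~ fixed phi y).
Proof.
move=> phiP fq; have [_ _ ra _] := phiP.
have [[a [e e0 ae]]|h] := pselect (exists a, exists2 e, 0 < e &
    forall y, q < y < q + e -> phi a y <> y).
  by exists e => //; right=> y /ae ay /(_ a).
have [e e0 He] := @common_radius R _ (fun a y => phi a y = y) q (fun a =>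
  match letter_germ (fq a) (ra a q) with
  | ex_intro2 e e0 (or_introl h1) => ex_intro2 _ _ e e0 h1
  | ex_intro2 e e0 (or_intror h2) =>
      False_ind _ (h (ex_intro _ a (ex_intro2 _ _ e e0 h2)))
  end).
by exists e => //; left=> y ye a; exact: He.
Qed.

(** The supremum of an invariant set is fixed, applied to the reflection of the
    fixed points above [q]. *)
Lemma next_fixed phi (q M : R) : pl_action phi -> ~ fixed phi q ->
  q < M -> fixed phi M ->
  exists b, [/\ q < b, fixed phi b & forall z, q <= z < b -> ~ fixed phi z].
Proof.
move=> phiP nq qM fM.
pose S := [set x | fixed (opp_action phi) x /\ x <= - q].
have iS : invariant (opp_action phi) S by move=> a x [fx xq]; rewrite fx.
have hS : has_sup S.
  split; last by exists (- q) => x [].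
  by exists (- M); split; [apply/fixed_opp; rewrite opprK|rewrite lerN2 ltW].
have /fixed_opp fb := sup_fixed (pl_opp_action phiP) iS hS.
have bq : sup S <= - q by apply: ge_sup; [case: hS|move=> x []].
exists (- sup S); split=> // [|z /andP[qz zb] fz].
  rewrite lt_neqAle lerNr bq andbT; apply: contra_notN nq => /eqP ->.
  exact: fb.
have : - z <= sup S.
  apply: ub_le_sup; first by case: hS.
  by split; [apply/fixed_opp; rewrite opprK|rewrite lerN2].
by lra.
Qed.

Lemma previous_fixed phi (q M : R) : pl_action phi -> ~ fixed phi q ->
  M < q -> fixed phi M ->
  exists b, [/\ b < q, fixed phi b & forall z, b < z <= q -> ~ fixed phi z].
Proof.
move=> phiP nq Mq fM.
have [||| b [qb fb nb]] :=
    @next_fixed (opp_action phi) (- q) (- M) (pl_opp_action phiP).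
- by move/fixed_opp; rewrite opprK.
- by rewrite ltrN2.
- by apply/fixed_opp; rewrite opprK.
exists (- b); split; [by lra|exact/fixed_opp|move=> z zbq fz].
by apply: (nb (- z)); [lra|apply/fixed_opp; rewrite opprK].
Qed.

Definition has_fixed_above phi := forall x, exists2 M, x < M & fixed phi M.

(** Near [q], on the right, affineness leaves two possibilities: all points are
    fixed, or none is, and then [q] is the left end of a component. *)
Lemma right_relator phi q : pl_action phi -> has_fixed_above phi ->
  fixed phi q ->
  exists2 e, 0 < e & exists2 V, relator_set phi V &
    forall y, q < y < q + e -> V y.
Proof.
move=> phiP above fq; have [e e0 [He|He]] := fixed_right_germ phiP fq.
  by exists e => //; exists (fixed phi) => //; exact: relator_set_fixed.
have [M qM fM] := above (q + e / 2).
have [|b [qb fb nb]] := next_fixed phiP (He (q + e / 2) _) qM fM; first by lra.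
exists e => //; exists [set x | q < x < b] => /=.
  apply: component_relator => //; first by lra.
  move=> z /andP[qz zb]; have [ze|ze] := leP (q + e / 2) z.
    by apply: nb; lra.
  by apply: He; lra.
move=> y /andP[qy ye]; rewrite qy ltNge; apply/negP => yb.
by apply: (He b) => //; lra.
Qed.

Lemma neighbourhood_relator phi q : pl_action phi ->
  has_fixed_above phi -> has_fixed_above (opp_action phi) ->
  exists2 e, 0 < e & exists2 V, relator_set phi V &
    forall y, q - e < y < q + e -> V y.
Proof.
move=> phiP above below.
have [fq|nq] := pselect (fixed phi q).
  have [e e0 [V goodV Ve]] := right_relator phiP above fq.
  have [|d d0 [U goodU Ud]] :=
      @right_relator _ (- q) (pl_opp_action phiP) below.
    by apply/fixed_opp; rewrite opprK.
  exists (Num.min e d); first by rewrite lt_min e0.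
  exists (fixed phi `|` (V `|` -%R @^-1` U)).
    apply: relator_setU => //; first exact: relator_set_fixed.
    by apply: relator_setU => //; exact: relator_set_opp.
  have ee : Num.min e d <= e by rewrite ge_min lexx.
  have ed : Num.min e d <= d by rewrite ge_min lexx orbT.
  move=> y /andP[y1 y2]; case: (ltgtP y q) => [yq|yq|->]; last by left.
    by right; right; apply: Ud => /=; lra.
  by right; left; apply: Ve; lra.
have [M qM fM] := above q; have [m qm /fixed_opp fm] := below (- q).
have [b [qb fb nb]] := next_fixed phiP nq qM fM.
have [|a [aq fa na]] := previous_fixed phiP nq _ fm; first by lra.
exists (Num.min (q - a) (b - q)); first by rewrite lt_min; lra.
exists [set x | a < x < b].
  apply: component_relator => //; first by lra.
  move=> z /andP[az zb]; have [zq|zq] := leP z q.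
    by apply: na; rewrite az.
  by apply: nb; rewrite (ltW zq).
have e1 : Num.min (q - a) (b - q) <= q - a by rewrite ge_min lexx.
have e2 : Num.min (q - a) (b - q) <= b - q by rewrite ge_min lexx orbT.
by move=> y /andP[y1 y2] /=; lra.
Qed.

Lemma segment_relation phi (a b : R) : a <= b -> pl_action phi ->
  has_fixed_above phi -> has_fixed_above (opp_action phi) ->
  has_relation phi [set x | a <= x <= b].
Proof.
move=> ab phiP above below.
have [V [_ [w [rw w0 wV]]] Vab] : exists2 V, relator_set phi V &
    forall x, a <= x <= b -> V x.
  apply: (@segment_gluing _ (fun u v => exists2 V, relator_set phi V &
    forall x, u <= x <= v -> V x)) => //
    [q _|u v w uv vw [V gV Vuv] [U gU Uvw]].
    have [e e0 [V gV Ve]] := neighbourhood_relator q phiP above below.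
    exists e => // u v qu uq qv vq; exists V => // x ux; apply: Ve; lra.
  exists (V `|` U); first exact: relator_setU.
  move=> x /andP[ux xw]; have [xv|vx] := leP x v; [left|right].
    by apply: Vuv; rewrite ux.
  by apply: Uvw; rewrite (ltW vx).
by exists w; split=> // x /Vab; exact: wV.
Qed.

End Relation.

(** * Lifts of elements of Thompson's group *)

Section Lifts.
Local Open Scope ring_scope.
Variable R : realType.
Implicit Types (F : R -> R) (x y z : R).

(** Two-sided, unlike [right_slope]: the slope at a point is then unique, which
    makes it propagate along an interval. *)
Definition slope_at F x l :=
  exists2 e, 0 < e & forall y, x - e < y < x + e -> F y = F x + l * (y - x).

Lemma slope_at_uniq F x l m : slope_at F x l -> slope_at F x m -> l = m.
Proof.
move=> [e e0 le] [d d0 md]; pose t := Num.min e d / 2.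
have t0 : 0 < t by rewrite divr_gt0// lt_min e0.
have te : t < e by rewrite ltr_pdivrMr// gt_min; apply/orP; left; lra.
have td : t < d by rewrite ltr_pdivrMr// gt_min; apply/orP; right; lra.
have := le (x + t); rewrite md; last by lra.
move=> E; apply: (mulIf (lt0r_neq0 t0)).
by have := E ltac:(lra); lra.
Qed.

Lemma slope_at_near F x l : (\forall y \near x, F y = F x + l * (y - x)) ->
  slope_at F x l.
Proof.
move=> /nbhs_ballP[e /= e0 He]; exists e => // y ye.
by apply: He; rewrite /ball /= ltr_norml; lra.
Qed.

(** The glued property of [y] and [z] records the slope at both ends, so that two
    consecutive segments are forced to have the same slope. *)
Lemma affine_between F u v : u < v ->
  (forall x, u < x < v -> exists l, slope_at F x l) ->
  exists l, forall y z, u < y -> y <= z -> z < v -> F z = F y + l * (z - y).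
Proof.
move=> uv loc; pose Q y z := exists l, [/\ slope_at F y l, slope_at F z l &
  F z = F y + l * (z - y)].
have QP y z : u < y -> y <= z -> z < v -> Q y z.
  move=> uy yz zv; apply: segment_gluing => // [x /andP[yx xz]|a b c _ _].
    have [|l [e e0 He]] := loc x; first by lra.
    have sl t : x - e < t < x + e -> slope_at F t l.
      move=> te; exists (Num.min (t - (x - e)) (x + e - t)).
        by rewrite lt_min; lra.
      set d := Num.min _ _.
      have e1 : d <= t - (x - e) by rewrite ge_min lexx.
      have e2 : d <= x + e - t by rewrite ge_min lexx orbT.
      by move=> s /andP[s1 s2]; rewrite (He t)// (He s); [ring|lra].
    exists e => // a b a1 a2 b1 b2.
    exists l; split; [apply: sl; lra|apply: sl; lra|].
    by rewrite (He a) ?(He b); [ring|lra|lra].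
  move=> [l [al bl E]] [m [bm cm E']]; rewrite (slope_at_uniq bm bl) in cm E'.
  by exists l; split=> //; rewrite E' E; ring.
have [|l ml] := loc ((u + v) / 2); first by lra.
have slope_l y : u < y -> y < v -> slope_at F y l.
  move=> uy yv; have [ym|my] := leP y ((u + v) / 2).
    by have [|||m [? mm _]] := QP y ((u + v) / 2);
      rewrite ?(slope_at_uniq ml mm)//; lra.
  by have [|||m [mm ? _]] := QP ((u + v) / 2) y;
    rewrite ?(slope_at_uniq ml mm)//; lra.
exists l => y z uy yz zv; have [m [ym _ ->]] := QP y z uy yz zv.
by rewrite (slope_at_uniq ym (slope_l y uy (le_lt_trans yz zv))).
Qed.

Lemma continuous_zero (D : R -> R) x : {for x, continuous D} ->
  (forall e : R, 0 < e -> exists2 y, `|x - y| < e & D y = 0) -> D x = 0.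
Proof.
move=> cD h; apply/eqP; apply: contraPT isT => D0.
have : \forall y \near x, D y != 0 by exact: cvgr_neq0 cD D0.
move=> /nbhs_ballP[e /= e0 He].
have [y ye Dy] := h e e0.
by have := He y ye; rewrite /= Dy eqxx.
Qed.

Lemma affine_closed F u v : u < v -> continuous F ->
  (forall x, u < x < v -> exists l, slope_at F x l) ->
  exists l, forall y z, u <= y -> y <= z -> z <= v -> F z = F y + l * (z - y).
Proof.
move=> uv cF /(affine_between uv)[l Hl]; exists l.
pose m := (u + v) / 2.
have um : u < m by rewrite /m; lra.
have mv : m < v by rewrite /m; lra.
pose D y := F y - (F m + l * (y - m)).
have cD : continuous D.
  move=> x; apply: cvgB; first exact: cF.
  apply: cvgD; first exact: cvg_cst.
  by apply: cvgM; [exact: cvg_cst|apply: cvgB; [exact: cvg_id|exact: cvg_cst]].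
have D0 y : u < y -> y < v -> D y = 0.
  move=> uy yv; rewrite /D; have [ym|my] := leP y m.
    by rewrite (Hl y m)//; ring.
  by rewrite (Hl m y)// ?(ltW my)//; ring.
have Dc y : u <= y -> y <= v -> D y = 0.
  move=> uy yv; apply: continuous_zero; first exact: cD.
  move=> e e0; pose t := Num.min e (v - u) / 3.
  have t0 : 0 < t by rewrite divr_gt0// lt_min e0 subr_gt0.
  have te : t < e by rewrite ltr_pdivrMr// gt_min; apply/orP; left; lra.
  have tv : 2 * t < v - u.
    have : Num.min e (v - u) <= v - u by rewrite ge_min lexx orbT.
    by rewrite /t; lra.
  have [ym|my] := leP y m.
    exists (y + t); first by rewrite ltr_norml; lra.
    by apply: D0; rewrite /m in ym *; lra.
  exists (y - t); first by rewrite ltr_norml; lra.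
  by apply: D0; rewrite /m in my *; lra.
move=> y z uy yz zv.
have := Dc y uy (le_trans yz zv); have := Dc z (le_trans uy yz) zv.
rewrite /D => /eqP; rewrite subr_eq0 => /eqP ->.
move=> /eqP; rewrite subr_eq0 => /eqP ->.
by ring.
Qed.

Lemma proj_surj (c : circle R) : exists x, proj x = c.
Proof. by exists (repr c); rewrite /proj reprK. Qed.

(** The reflected point [2 * x - y] covers the left side of [x]. *)
Lemma proj_isolated (c : circle R) x :
  exists2 e, 0 < e &
    forall y, x < y < x + e -> proj y <> c /\ proj (2 * x - y) <> c.
Proof.
have [z <-{c}] := proj_surj c.
pose e1 := z + (Num.floor (x - z) + 1)%:~R - x.
pose e2 := x - z - (Num.ceil (x - z) - 1)%:~R.
have e10 : 0 < e1 by have := floorD1_gt (x - z); rewrite /e1; lra.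
have e20 : 0 < e2 by have := ceilB1_lt (x - z); rewrite /e2; lra.
exists (Num.min e1 e2); first by rewrite lt_min e10.
move=> y; rewrite addr_minr lt_min => /and3P[xy ye1 ye2].
split=> /projP /intrP[k Ek].
- have : Num.floor (x - z) < k.
    by rewrite -(ltr_int R) -Ek (le_lt_trans (floor_le _))//; lra.
  rewrite -lezD1 -(ler_int R) -Ek => h.
  by move: ye1; rewrite /e1; lra.
- have : k < Num.ceil (x - z).
    by rewrite -(ltr_int R) -Ek (lt_le_trans _ (ceil_ge _))//; lra.
  rewrite -lezD1 -(ler_int R) intrD -Ek => h.
  by move: ye2; rewrite /e2 intrB; lra.
Qed.

Lemma finite_isolated (B : set (circle R)) x : finite_set B ->
  exists2 e, 0 < e &
    forall y, x < y < x + e -> ~ B (proj y) /\ ~ B (proj (2 * x - y)).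
Proof.
move=> /finite_seqP[s ->]; pose P (i : 'I_(size s)) y :=
  proj y <> tnth (in_tuple s) i /\ proj (2 * x - y) <> tnth (in_tuple s) i.
have [i|e e0 He] := @common_radius R _ P x; first exact: proj_isolated.
exists e => // y ye; split=> /= /seq_tnthP[i Ei].
  by case: (He i y ye) => /(_ Ei).
by case: (He i y ye) => _ /(_ Ei).
Qed.

(** The breakpoints on the line are isolated, so beside [x] the slope is locally
    constant, hence constant, and continuity extends the formula to [x]. *)
Lemma piecewise_linear_affine F x : continuous F -> dyadic_piecewise_linear F ->
  right_affine F x /\ right_affine (point_reflection F) (- x).
Proof.
move=> cF [B [Bfin _ FB]]; have [e e0 He] := finite_isolated x Bfin.
have slope y : ~ B (proj y) -> exists l, slope_at F y l.
  by move=> /FB[k kP]; exists (2 ^ k); exact: slope_at_near.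
split.
- have [|y ye|l Hl] := @affine_closed F x (x + e / 2) _ cF; first by lra.
    by apply: slope; apply: (He y _).1; lra.
  by exists (e / 2); [lra|exists l => y ye; apply: Hl; lra].
- have [|y ye|l Hl] := @affine_closed F (x - e / 2) x _ cF; first by lra.
    have -> : y = 2 * x - (2 * x - y) by ring.
    by apply: slope; apply: (He (2 * x - y) _).2; lra.
  exists (e / 2); first by lra.
  exists l => y ye; rewrite /point_reflection opprK.
  by rewrite (Hl (- y) x); [ring|lra|lra|lra].
Qed.

Lemma lift_addz F (n : int) x : (forall x, F (x + 1) = F x + 1) ->
  F (x + n%:~R) = F x + n%:~R.
Proof.
move=> F1; have Fn (m : nat) y : F (y + m%:R) = F y + m%:R.
  by elim: m => [|m IH]; rewrite ?addr0// -natr1 !addrA F1 IH.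
case: n => n; first by rewrite -pmulrn Fn.
by rewrite NegzE mulrNz -pmulrn -[in RHS](subrK n.+1%:R x) Fn addrK.
Qed.

Lemma int_small (x : R) : x \is a Num.int -> `|x| < 1 -> x = 0.
Proof.
move=> xZ; have [//|x0] := eqVneq x 0.
by rewrite ltNge norm_intr_ge1.
Qed.

(** A lift of the identity moves points by integers; monotonicity keeps it
    within the period [[x0 + n, x0 + n + 1)] containing the point. *)
Lemma lift_of_id F x0 : {homo F : x y / x < y} ->
  (forall x, F (x + 1) = F x + 1) -> (forall x, proj (F x) = proj x) ->
  F x0 = x0 -> F =1 id.
Proof.
move=> mF F1 pF Fx0 x; pose n := Num.floor (x - x0).
have n1 : x0 + n%:~R <= x by have := floor_le (x - x0); rewrite -/n; lra.
have n2 : x < x0 + (n + 1)%:~R by have := floorD1_gt (x - x0); rewrite -/n; lra.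
have mleF : {mono F : x y / x <= y} by exact: le_mono.
have mltF : {mono F : x y / x < y} by exact: leW_mono.
have := n1; rewrite -mleF lift_addz// Fx0 => N1.
have := n2; rewrite -mltF lift_addz// Fx0 => N2.
apply/eqP; rewrite -subr_eq0; apply/eqP/int_small; first exact/projP.
by rewrite intrD in n2 N2; rewrite ltr_norml; lra.
Qed.

Lemma fixing_lift (f : thompson R) x0 : sval f (proj x0) = proj x0 ->
  exists F, [/\ F x0 = x0, increasing_lift (sval f) F,
    forall x, right_affine F x & forall x, right_affine (point_reflection F) x].
Proof.
move=> fx0; case: f fx0 => f [_ _ [F [[cF mF F1 Ff] plF]]] /= fx0.
have /projP/intrP[k Ek] : proj (F x0) = proj x0 by rewrite Ff.
exists (fun x => F x - k%:~R); split.
- by rewrite -Ek subKr.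
- split=> [x|x y xy|x|x].
  + by apply: cvgB; [exact: cF|exact: cvg_cst].
  + by rewrite ltrD2r; exact: mF.
  + by rewrite F1 addrAC.
  + rewrite -Ff; apply/projP; rewrite addrAC subrr add0r rpredN.
    exact: intr_int.
- move=> x; have [[e e0 [l He]] _] := piecewise_linear_affine x cF plF.
  by exists e => //; exists l => y ye; rewrite He//; ring.
- move=> x; have [_ [e e0 [l He]]] := piecewise_linear_affine (- x) cF plF.
  rewrite opprK in He; exists e => //; exists l => y ye.
  by have := He y ye; rewrite /point_reflection; lra.
Qed.

(** The lifts fixing [x0] represent the letters on the line, inverse letters by
    inverse maps because [lift_of_id] makes such lifts unique. They fix all
    translates of [x0], and one period covers the circle. *)
Lemma thompson_relation n (f : 'I_n.+2 -> thompson R) (p : circle R) :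
  (forall i, sval (f i) p = p) ->
  exists w, [/\ reduced w, w <> [::] & eval_word f w = 1%g].
Proof.
have [x0 <-{p}] := proj_surj p => fp.
pose g (a : 'I_n.+2 * bool) := if a.2 then f a.1 else ((f a.1)^-1)%g.
have gK a : cancel (sval (g a)) (sval (g (inv_letter a))).
  have ga : (g (inv_letter a) * g a)%g = 1%g.
    by case: a => i []; rewrite /g /= ?mulVg ?mulgV.
  by move=> c; rewrite -[LHS]/(sval (g (inv_letter a) * g a)%g c) ga.
have gp a : sval (g a) (proj x0) = proj x0.
  case: a => i []; first exact: fp.
  rewrite -[in LHS](fp i).
  exact: (gK (i, true)).
pose phi : action R n := fun a => projT1 (cid (fixing_lift (gp a))).
have phi0 a : phi a x0 = x0 by rewrite /phi; case: cid => F [].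
have phiL a : increasing_lift (sval (g a)) (phi a).
  by rewrite /phi; case: cid => F [].
have phi1 a x : phi a (x + 1) = phi a x + 1 by case: (phiL a).
have phiP : pl_action phi.
  split=> [a|a|a|a]; last 3 first.
  - by case: (phiL a).
  - by rewrite /phi; case: cid => F [].
  - by rewrite /phi; case: cid => F [].
  apply: (@lift_of_id (phi (inv_letter a) \o phi a) x0) => [x y xy|x|x|] /=.
  - have [_ h _ _] := phiL (inv_letter a); apply: h.
    by have [_ + _ _] := phiL a; apply.
  - by rewrite !phi1.
  - have [_ _ _ ->] := phiL (inv_letter a); have [_ _ _ ->] := phiL a.
    exact: gK.
  - by rewrite !phi0.
have fixedz (k : int) : fixed phi (x0 + k%:~R).
  by move=> a; rewrite (lift_addz _ _ (phi1 a)) phi0.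
have above : has_fixed_above phi.
  move=> x; exists (x0 + (Num.floor (x - x0) + 1)%:~R) => //.
  by have := floorD1_gt (x - x0); lra.
have below : has_fixed_above (opp_action phi).
  move=> x; exists (- (x0 + (Num.floor (- x - x0) - 1)%:~R)).
    by have := floor_le (- x - x0); rewrite intrD; lra.
  by apply/fixed_opp; rewrite opprK.
have [|w [rw w0 wx]] := @segment_relation _ _ _ x0 (x0 + 1) _ phiP above below.
  by lra.
exists w; split=> //; apply: thompson_eq => c.
have act_proj u x : sval (eval_word f u) (proj x) = proj (act phi u x).
  elim: u x => [|a u IH] x; first by rewrite eval_word_nil.
  rewrite eval_word_cons /= IH; have [_ _ _ ->] := phiL a.
  by [].
have [x <-{c}] := proj_surj c; pose y := x - (Num.floor (x - x0))%:~R.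
have -> : proj x = proj y.
  by apply/projP; rewrite /y opprB addrCA subrr addr0 intr_int.
rewrite act_proj wx//= /y.
have := floor_le (x - x0); have := floorD1_gt (x - x0); rewrite intrD; lra.
Qed.

End Lifts.

(** * Two elements with disjoint supports *)

Section DisjointSupports.
Local Open Scope ring_scope.
Variable R : realType.
Implicit Types (F G h : R -> R) (x y z : R).

Definition dyadic : set R :=
  [set x | exists (m : int) (k : nat), x = m%:~R / 2 ^+ k].

Lemma dyadicD x y : dyadic x -> dyadic y -> dyadic (x + y).
Proof.
move=> [m [j ->]] [n [k ->]]; exists (m * 2 ^+ k + n * 2 ^+ j), (j + k)%N.
rewrite intrD !intrM !rmorphXn /= exprD -[2%:~R]/(2 : R).
by field; rewrite !expf_neq0.
Qed.

Lemma dyadicM x y : dyadic x -> dyadic y -> dyadic (x * y).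
Proof.
move=> [m [j ->]] [n [k ->]]; exists (m * n), (j + k)%N.
by rewrite intrM exprD; field; rewrite !expf_neq0.
Qed.

Lemma dyadic_int (m : int) : dyadic m%:~R.
Proof. by exists m, 0%N; rewrite expr0 divr1. Qed.

Lemma dyadic_half : dyadic 2^-1.
Proof. by exists 1, 1%N; rewrite expr1 mul1r. Qed.

(** An increasing bijection maps intervals onto intervals. *)
Lemma increasing_inverse_continuous F G : {homo F : x y / x < y} ->
  cancel F G -> cancel G F -> continuous G.
Proof.
move=> mF FK GK; have mltF : {mono F : x y / x < y} by apply/leW_mono/le_mono.
move=> y; apply/cvgrPdist_lt => e e0.
have h1 : F (G y - e) < y by rewrite -[ltRHS]GK mltF; lra.
have h2 : y < F (G y + e) by rewrite -[ltLHS]GK mltF; lra.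
near=> z.
have z1 : F (G y - e) < z by near: z; exact: lt_nbhsr.
have z2 : z < F (G y + e) by near: z; exact: lt_nbhsl.
rewrite -[z in _ < z]GK mltF in z1.
rewrite -[z in z < _]GK mltF in z2.
by rewrite distrC ltr_distl z1.
Unshelve. all: by end_near.
Qed.

Lemma thompson_of_lift F G : cancel F G -> cancel G F ->
  {homo F : x y / x < y} -> (forall x, F (x + 1) = F x + 1) ->
  (forall x, dyadic x -> dyadic (F x)) ->
  (forall x, dyadic x -> dyadic (G x)) ->
  dyadic_piecewise_linear F ->
  exists f : thompson R, forall x, sval f (proj x) = proj (F x).
Proof.
move=> FK GK mF F1 dF dG plF.
have mG : {homo G : x y / x < y}.
  have mltF : {mono F : x y / x < y} by apply/leW_mono/le_mono.
  by move=> x y xy; rewrite -mltF !GK.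
have G1 x : G (x + 1) = G x + 1 by apply: (can_inj FK); rewrite F1 !GK.
have cF : continuous F by exact: increasing_inverse_continuous mG GK FK.
have cG : continuous G by exact: increasing_inverse_continuous mF FK GK.
pose lower (H : R -> R) (c : circle R) : circle R := proj (H (repr c)).
have lowerE (H : R -> R) (x : R) : (forall x, H (x + 1) = H x + 1) ->
    lower H (proj x) = proj (H x).
  move=> H1; have /projP/intrP[n En] : proj (repr (proj x)) = proj x.
    by rewrite /proj reprK.
  apply/projP; have -> : repr (proj x) = x + n%:~R by rewrite -En addrC subrK.
  by rewrite lift_addz// addrAC subrr add0r intr_int.
have lowerC (H : R -> R) : (forall x, H (x + 1) = H x + 1) -> continuous H ->
    continuous (lower H).
  move=> H1 cH; apply/quotient_continuous.
  rewrite (_ : _ \o _ = (@proj R : R -> circle R) \o H); last first.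
    by apply/funext => x; exact: lowerE.
  by move=> x; apply: continuous_comp; [exact: cH|exact: pi_continuous].
have lowerK (H K : R -> R) : (forall x, H (x + 1) = H x + 1) ->
    (forall x, K (x + 1) = K x + 1) -> cancel H K ->
    cancel (lower H) (lower K).
  by move=> H1 K1 HK c; have [x <-] := proj_surj c; rewrite !lowerE// HK.
have fT : thompson_map (lower F).
  split.
  - by exists (lower G); split; by [exact: lowerK|exact: lowerC].
  - apply/seteqP; split=> c /=.
      by move=> [_ [x dx <-] <-]; exists (F x); [exact: dF|rewrite lowerE].
    move=> [x dx <-{c}]; exists (proj (G x)); last by rewrite lowerE// GK.
    by exists (G x) => //; exact: dG.
  - exists F; split=> //; split=> // x; by rewrite lowerE.
by exists (exist _ (lower F) fT) => x; exact: lowerE.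
Qed.

Definition frac x : R := x - (Num.floor x)%:~R.

Lemma frac_itv x : 0 <= frac x < 1.
Proof. by have := floor_itv x; rewrite /frac intrD; lra. Qed.

Lemma floor_shift (n : int) y : 0 <= y < 1 -> Num.floor (n%:~R + y) = n.
Proof. by move=> y01; apply: floor_def; rewrite intrD; lra. Qed.

Definition periodize h x : R := (Num.floor x)%:~R + h (frac x).

Definition itv_map h := forall y, 0 <= y < 1 -> 0 <= h y < 1.

Lemma periodize_itv h (n : int) y : 0 <= y < 1 ->
  periodize h (n%:~R + y) = n%:~R + h y.
Proof.
by move=> y01; rewrite /periodize /frac floor_shift// (addrC _ y) addrK.
Qed.

Lemma floor_frac x : x = (Num.floor x)%:~R + frac x.
Proof. by rewrite /frac addrC subrK. Qed.

Lemma periodize1 h x : periodize h (x + 1) = periodize h x + 1.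
Proof.
rewrite [x]floor_frac addrAC -(intrD _ _ 1) !periodize_itv ?frac_itv//.
by rewrite intrD addrAC.
Qed.

Lemma periodizeK h k : itv_map h -> (forall y, 0 <= y < 1 -> k (h y) = y) ->
  cancel (periodize h) (periodize k).
Proof.
move=> hI hk x; have y01 := frac_itv x.
by rewrite [x]floor_frac !periodize_itv ?hk//; exact: hI.
Qed.

Lemma periodize_homo h : itv_map h ->
  (forall x y, 0 <= x -> x < y -> y < 1 -> h x < h y) ->
  {homo periodize h : x y / x < y}.
Proof.
move=> hI mh x y xy; rewrite /periodize.
have hx := hI _ (frac_itv x); have hy := hI _ (frac_itv y).
have /andP[x0 x1] := frac_itv x; have /andP[y0 y1] := frac_itv y.
have := le_floor (ltW xy); rewrite le_eqVlt => /predU1P[Exy|].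
  rewrite Exy ltrD2l; apply: mh => //.
  by have := xy; rewrite /frac Exy; lra.
by rewrite -lezD1 -(ler_int R) intrD; lra.
Qed.

Lemma dyadic_periodize h : (forall y, dyadic y -> dyadic (h y)) ->
  forall x, dyadic x -> dyadic (periodize h x).
Proof.
move=> dh x dx; apply: dyadicD; first exact: dyadic_int.
by apply: dh; apply: dyadicD => //; rewrite -intrN; exact: dyadic_int.
Qed.

Lemma periodize_linear_piece h (p q beta : R) (k : int) x :
  0 <= p -> q <= 1 -> (forall y, p < y < q -> h y = 2 ^ k * y + beta) ->
  p < frac x < q ->
  \forall y \near x, periodize h y = periodize h x + 2 ^ k * (y - x).
Proof.
move=> p0 q1 hk xpq; set n := (Num.floor x)%:~R : R.
have piece y : n + p < y -> y < n + q ->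
    periodize h y = n + (2 ^ k * (y - n) + beta).
  move=> yp yq; rewrite -{1}(subrK n y) addrC periodize_itv ?hk//; lra.
have [xp xq] : n + p < x /\ x < n + q by move: xpq; rewrite /frac -/n; lra.
near=> y; rewrite !piece//; first by ring.
- by near: y; exact: lt_nbhsr.
- by near: y; exact: lt_nbhsl.
Unshelve. all: by end_near.
Qed.

(** An element of Thompson's group F squeezed into [0, 1/2]. *)
Definition bump y : R :=
  if y < 1/8 then 2 * y else if y < 1/4 then y + 1/8
  else if y < 1/2 then 1/2 * y + 1/4 else y.

Definition bump_inv y : R :=
  if y < 1/4 then 1/2 * y else if y < 3/8 then y - 1/8
  else if y < 1/2 then 2 * y - 1/2 else y.

Lemma bump_piecewise_linear : dyadic_piecewise_linear (periodize bump).
Proof.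
exists [set c : circle R |
  c \in [:: proj 0; proj (1/8); proj (1/4); proj (1/2)]].
split.
- exact: finite_seq.
- have d1 k : dyadic_circle (proj (1 / 2 ^+ k : R)).
    by exists (1 / 2 ^+ k) => //; exists 1, k.
  move=> c /=; rewrite !inE => /or4P[] /eqP ->.
  + by exists 0 => //; exists 0, 0%N; rewrite mul0r.
  + by have := d1 3; rewrite (_ : 2 ^+ 3 = 8 :> R)//; ring.
  + by have := d1 2; rewrite (_ : 2 ^+ 2 = 4 :> R)//; ring.
  + by have := d1 1%N; rewrite expr1.
- move=> x xB; have /andP[x0 x1] := frac_itv x.
  have neq t : proj t \in [:: proj 0; proj (1/8); proj (1/4); proj (1/2 : R)] ->
      frac x <> t.
    move=> tB E; apply: xB; rewrite /= (_ : proj x = proj t)//.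
    by apply/projP; rewrite -E /frac subKr intr_int.
  have := neq 0; have := neq (1/8); have := neq (1/4); have := neq (1/2).
  rewrite !inE !eqxx !orbT => /(_ isT)/eqP n2 /(_ isT)/eqP n4 /(_ isT)/eqP n8.
  move=> /(_ isT)/eqP n0.
  have x0' : 0 < frac x by rewrite lt_def n0.
  have piece := @periodize_linear_piece bump.
  have [x8|x8|E] := ltgtP (frac x) (1/8); last by rewrite E eqxx in n8.
    exists 1; apply: (piece 0 (1/8) 0); [lra|lra| |by rewrite x0'].
    move=> y /andP[y0 y8]; rewrite /bump y8 expr1z; lra.
  have [x4|x4|E] := ltgtP (frac x) (1/4); last by rewrite E eqxx in n4.
    exists 0; apply: (piece (1/8) (1/4) (1/8)); [lra|lra| |by rewrite x8].
    move=> y /andP[y0 y8]; rewrite /bump expr0z; do ?[case: (ltP y _) => ?]; lra.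
  have [x2|x2|E] := ltgtP (frac x) (1/2); last by rewrite E eqxx in n2.
    exists (-1); apply: (piece (1/4) (1/2) (1/4)); [lra|lra| |by rewrite x4].
    move=> y /andP[y0 y8]; rewrite /bump y8 exprN1; do ?[case: (ltP y _) => ?]; lra.
  exists 0; apply: (piece (1/2) 1 0); [lra|lra| |by rewrite x2].
  move=> y /andP[y0 y8]; rewrite /bump expr0z; do ?[case: (ltP y _) => ?]; lra.
Qed.

Lemma bump_itv : itv_map bump.
Proof. by move=> y y01; rewrite /bump; do ?[case: (ltP y _) => ?]; lra. Qed.

Lemma bump_inv_itv : itv_map bump_inv.
Proof. by move=> y y01; rewrite /bump_inv; do ?[case: (ltP y _) => ?]; lra. Qed.

Lemma bumpK y : 0 <= y < 1 -> bump_inv (bump y) = y.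
Proof.
move=> /andP[y0 _]; rewrite /bump /bump_inv.
by do ?[case: (ltP y _) => ?]; do ?[case: ltP => ?]; lra.
Qed.

Lemma bump_invK y : 0 <= y < 1 -> bump (bump_inv y) = y.
Proof.
move=> /andP[y0 _]; rewrite /bump /bump_inv.
by do ?[case: (ltP y _) => ?]; do ?[case: ltP => ?]; lra.
Qed.

Lemma bump_lt x y : 0 <= x -> x < y -> y < 1 -> bump x < bump y.
Proof.
move=> x0 xy _; rewrite /bump.
by do ?[case: (ltP y _) => ?]; do 3?[case: (ltP x _) => ?]; lra.
Qed.

Lemma bump_element : exists f : thompson R,
  forall x, sval f (proj x) = proj (periodize bump x).
Proof.
have dV k : dyadic (1 / 2 ^+ k) by exists 1, k.
have d2 : dyadic 2 by have := dyadic_int 2.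
have d12 : dyadic (1/2) by have := dV 1%N; rewrite expr1.
have d14 : dyadic (1/4) by have := dV 2; rewrite (_ : 2 ^+ 2 = 4)//; ring.
have d18 : dyadic (1/8) by have := dV 3; rewrite (_ : 2 ^+ 3 = 8)//; ring.
have dB x y : dyadic x -> dyadic y -> dyadic (x - y).
  move=> dx dy; apply: dyadicD => //; rewrite -mulN1r.
  by apply: dyadicM => //; exact: (dyadic_int (-1)).
apply: (@thompson_of_lift _ (periodize bump_inv)).
- exact: periodizeK bump_itv bumpK.
- exact: periodizeK bump_inv_itv bump_invK.
- exact: periodize_homo bump_itv bump_lt.
- exact: periodize1.
- apply: dyadic_periodize => y dy; rewrite /bump.
  case: ifP => _; first exact: dyadicM.
  case: ifP => _; first exact: dyadicD.
  by case: ifP => _ //; apply: dyadicD; [exact: dyadicM|].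
- apply: dyadic_periodize => y dy; rewrite /bump_inv.
  case: ifP => _; first exact: dyadicM.
  case: ifP => _; first exact: dB.
  by case: ifP => _ //; apply: dB; [exact: dyadicM|].
- exact: bump_piecewise_linear.
Qed.

Lemma half_rotation : exists f : thompson R,
  forall x, sval f (proj x) = proj (x + 1/2).
Proof.
have d12 : dyadic (1/2) by rewrite mul1r; exact: dyadic_half.
apply: (@thompson_of_lift _ (fun x => x - 1/2)).
- exact: addrK.
- exact: subrK.
- by move=> x y; rewrite ltrD2r.
- by move=> x; rewrite addrAC.
- by move=> x dx; exact: dyadicD.
- move=> x dx; apply: dyadicD => //; rewrite -mulN1r.
  by apply: dyadicM => //; exact: (dyadic_int (-1)).
- exists set0; split=> // x _; exists 0; near=> y; rewrite expr0z; ring.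
Unshelve. all: by end_near.
Qed.

(** [bump] moves only the arc [(0, 1/2)]; its conjugate by the half turn moves
    only the opposite arc, and both fix the image of [0]. *)
Lemma disjoint_supports : exists (g1 g2 : thompson R) (z : circle R),
  [/\ g1 <> 1%g, g2 <> 1%g, sval g1 z = z, sval g2 z = z &
      forall c, sval g1 c = c \/ sval g2 c = c].
Proof.
have [g gE] := bump_element; have [r rE] := half_rotation.
have g_fix x : 1/2 <= frac x -> sval g (proj x) = proj x.
  move=> x2; rewrite gE /periodize /bump.
  do ?[case: (ltP (frac x) _) => ?]; try by exfalso; lra.
  by rewrite -floor_frac.
have gr_fix x : frac x < 1/2 -> sval (r * g * r^-1)%g (proj x) = proj x.
  move=> x2; have xE : proj x = sval r (proj (x + 1/2)).
    rewrite rE; apply/projP.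
    by rewrite (_ : x - _ = - 1); [rewrite rpredN rpred1|lra].
  rewrite [in LHS]xE -[LHS]/(sval (r * g * r^-1 * r)%g (proj (x + 1/2))).
  rewrite -mulgA mulVg mulg1 /= g_fix -?xE//.
  have ? := frac_itv x.
  have -> : x + 1/2 = (Num.floor x)%:~R + (frac x + 1/2) by rewrite /frac; ring.
  by rewrite {1}/frac floor_shift; lra.
have f0 : frac 0 = 0 by rewrite /frac floor0 subr0.
have g0 : sval g (proj 0) = proj 0.
  by rewrite gE /periodize f0 floor0 add0r /bump ltr_pdivlMr// mul0r ltr01 mulr0.
have g1 : g <> 1%g.
  move=> E; have := gE (1/4); rewrite E /=.
  have f4 : frac (1/4) = 1/4.
    by have := @floor_shift 0 (1/4); rewrite /frac add0r => ->; lra.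
  have -> : periodize bump (1/4) = 3/8.
    rewrite /periodize f4 /bump; do ?[case: (ltP (1/4) _) => ?]; try lra.
    by have := @floor_shift 0 (1/4); rewrite add0r => ->; lra.
  move/projP/int_small => h.
  have : (1/4 - 3/8 : R) = 0 by apply: h; rewrite ltr_norml; lra.
  lra.
exists g, (r * g * r^-1)%g, (proj 0); split=> //.
- move=> /(canRL (mulgK _)); rewrite mul1g invgK => E; apply: g1.
  by apply: (mulgI r); rewrite mulg1.
- by apply: gr_fix; rewrite f0; lra.
- move=> c; have [x <-] := proj_surj c.
  by have [x2|x2] := leP (1/2) (frac x); [left; exact: g_fix|right; exact: gr_fix].
Qed.

End DisjointSupports.

(** * Conjugates by the centralizer *)

Local Open Scope group_scope.

(** [s g r = g^s (s r)], and [c] fixes the second factor. *)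
Lemma conjl_centralizer (G : groupType) (g r s c : G) : centralizer (s * r) c ->
  conjl (s * g * r) c = conjl g (c * s) * (s * r).
Proof.
rewrite /centralizer /= => sc.
have {}sc : (s * r) * c^-1 = c^-1 * (s * r).
  by apply: (mulgI c); rewrite mulgA sc mulgK mulgA mulgV mul1g.
have -> : s * g * r = s * g * s^-1 * (s * r) by rewrite mulgA mulgVK.
by rewrite /conjl invgM -!mulgA (mulgA s r) sc.
Qed.

Lemma conjl_fixed (R : realType) (g a : thompson R) (q : circle R) :
  sval g (sval a^-1 q) = sval a^-1 q -> sval (conjl g a) q = q.
Proof. by move=> /= ->; rewrite -[LHS]/(sval (a * a^-1) q) mulgV. Qed.

(** The index [k] is used up in removing [t]; setting [y k] to [1] in the
    relation between [y i * (y k)^-1] and [y j * (y k)^-1] leaves one between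
    [y i] and [y j]. *)
Lemma common_fixed_point_not_free (R : realType) n (y h : 'I_n -> thompson R)
    (t : thompson R) (p : circle R) (i j k : 'I_n) :
  i != j -> i != k -> j != k -> (forall l, y l = h l * t) ->
  sval (h i) p = p -> sval (h j) p = p -> sval (h k) p = p ->
  ~ freely_independent y.
Proof.
move=> ij ik jk yE hi hj hk yF.
pose e (l : 'I_2) := if l == ord0 then i else j.
have eI : injective e.
  rewrite /e => -[[|[|//]] l] [[|[|//]] m] /=; rewrite -?val_eqE /= => E;
    by apply: val_inj => //=; rewrite E eqxx in ij.
have ek l : e l != k by rewrite /e; case: ifP.
have he l : sval (h (e l)) p = p by rewrite /e; case: ifP.
have hk' : sval (h k)^-1 p = p.
  by rewrite -[in LHS]hk -[LHS]/(sval ((h k)^-1 * h k) p) mulVg.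
have [w [rw w0 Ew]] : exists w : word 2, [/\ reduced w, w <> [::] &
    eval_word (fun l => y (e l) * (y k)^-1) w = 1].
  apply: (@thompson_relation R 0 _ p) => l.
  rewrite !yE invgM mulgA mulgK -[LHS]/(sval (h (e l)) (sval (h k)^-1 p)).
  by rewrite hk' he.
pose v l : word n := [:: (e l, true); (k, false)].
have vE (G : groupType) (x : 'I_n -> G) l :
    eval_word x (v l) = x (e l) * (x k)^-1.
  by rewrite /v !eval_word_cons eval_word_nil mulg1.
pose z l := if l == k then 1 else y l.
have zw : eval_word z (subst_word v w) = 1.
  rewrite -(eval_word_nil z); apply: (free_relation _ yF).
  by rewrite eval_subst_word (eq_eval_word _ (vE _ _)) Ew eval_word_nil.
pose u : word n := [seq (e a.1, a.2) | a <- w].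
have u0 : u <> [::] by rewrite /u; case: (w) w0.
apply: (yF u _ u0); first by rewrite reduced_map.
rewrite eval_word_map -zw eval_subst_word; apply: eq_eval_word => l /=.
by rewrite vE /z (negbTE (ek l)) eqxx invg1 mulg1.
Qed.

Theorem lemma7 (R : realType) :
  exists g1 g2 : thompson R, [/\ g1 <> 1, g2 <> 1 &
    forall r s : thompson R,
      ~ exists c : 'I_4 -> thompson R,
          [/\ forall i, centralizer (s * r) (c i),
              free_of_rank 4
                (generated (range (fun i => conjl (s * g1 * r) (c i)))) &
              free_of_rank 4
                (generated (range (fun i => conjl (s * g2 * r) (c i))))]].
Proof.
have [g1 [g2 [z [g1_neq1 g2_neq1 g1z g2z g12]]]] := disjoint_supports R.
exists g1, g2; split=> // r s [c [cC /generators_freely_independent free1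
  /generators_freely_independent free2]].
pose h (g : thompson R) i := conjl g (c i * s).
pose p := sval (c ord0 * s) z.
have not_free (g : thompson R) i j k : i != j -> i != k -> j != k ->
    freely_independent (fun i => conjl (s * g * r) (c i)) ->
    sval (h g i) p = p -> sval (h g j) p = p -> sval (h g k) p = p -> False.
  move=> ij ik jk gF hi hj hk.
  apply: (common_fixed_point_not_free ij ik jk _ hi hj hk gF) => l.
  exact: conjl_centralizer.
have h0 (g : thompson R) : sval g z = z -> sval (h g ord0) p = p.
  move=> gz; apply: conjl_fixed.
  have -> : sval (c ord0 * s)^-1 p = z by
    rewrite -[LHS]/(sval ((c ord0 * s)^-1 * (c ord0 * s)) z) mulVg.
  exact: gz.
have h12 i : sval (h g1 i) p = p \/ sval (h g2 i) p = p.
  by have [/conjl_fixed|/conjl_fixed] := g12 (sval (c i * s)^-1 p); [left|right].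
pose i1 : 'I_4 := @Ordinal 4 1 isT; pose i2 : 'I_4 := @Ordinal 4 2 isT.
pose i3 : 'I_4 := @Ordinal 4 3 isT.
have h01 := h0 g1 g1z; have h02 := h0 g2 g2z.
have two1 i j : ord0 != i -> ord0 != j -> i != j ->
  sval (h g1 i) p = p -> sval (h g1 j) p = p -> False.
  by move=> i0 j0 ij; exact: (not_free g1 ord0 i j).
have two2 i j : ord0 != i -> ord0 != j -> i != j ->
  sval (h g2 i) p = p -> sval (h g2 j) p = p -> False.
  by move=> i0 j0 ij; exact: (not_free g2 ord0 i j).
have [a1|a1] := h12 i1; have [a2|a2] := h12 i2; have [a3|a3] := h12 i3.
- exact: (two1 i1 i2).
- exact: (two1 i1 i2).
- exact: (two1 i1 i3).
- exact: (two2 i2 i3).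
- exact: (two1 i2 i3).
- exact: (two2 i1 i3).
- exact: (two2 i1 i2).
- exact: (two2 i1 i2).
Qed.
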